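(* There exists an absolute constant $C$ such that the following holds. Let $\{Y_i\}_{i=1}^{\infty}$ be a stationary Markov chain with state space $[N]$, transition matrix $A$, stationary probability measure $\pi$, and averaging operator $E_{\pi}$, so that $Y_1$ is distributed according to $\pi$. Let $\lambda = \|A-E_{\pi}\|_{L_2(\pi) \rightarrow L_2(\pi)}$, let $f: [N] \rightarrow [-1, 1]$ be such that $\mathbb{E}[f(Y_i)] = 0$, and let $B=(b_{i,j}) \in \mathbb{R}^{d \times d}$ be a symmetric $d \times d$ matrix with positive entries. Let $\mathcal{I}\subseteq [d]\times[d]$ be the set of pairs $(i,j)$ such that $i\le j$. For any injective function $\omega: \mathcal{I} \rightarrow \{1, 2, \ldots, (d^2+d)/2\}$, let $X$ be the random symmetric $d\times d$ matrix defined by \[ X_{i, j} = \begin{cases} f(Y_{\omega(i, j)})\,b_{i, j} & \text{ if } (i, j) \in \mathcal{I},\\ f(Y_{\omega(j, i)})\, b_{j, i} & \text{ otherwise.} \end{cases} \] Then \[ \mathbb{E}[\|X\|_{S_{\infty}}] \leq \min\left\{\frac{C}{\sqrt{1-\lambda}} \left(\sigma + \sigma_*\sqrt{\log d}\right), \|B\|_{S_{\infty}}\right\}, \] where \[ \sigma = \max_{i} \sqrt{\sum_j b_{i, j}^2} \quad\text{and}\quad \sigma_* = \max_{i, j} |b_{i, j}|. \]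
   Context: $[N]=\{1,\ldots,N\}$ and $[d]=\{1,\ldots,d\}$. The transition matrix $A\in\mathbb{R}^{N\times N}$ is row-stochastic, with $A_{ij}$ the probability of moving from $i$ to $j$, and $\pi$ is a probability distribution on $[N]$ with positive entries satisfying $\sum_i \pi_i A_{ij}=\pi_j$ for all $j$. The chain is not assumed to be reversible. The averaging operator $E_\pi\in\mathbb{R}^{N\times N}$ is the matrix $(E_\pi)_{ij}=\pi_j$. For $v\in\mathbb{R}^N$, $\|v\|_{L_2(\pi)}=\left(\sum_{i=1}^N \pi_i |v_i|^2\right)^{1/2}$, and for $T\in\mathbb{R}^{N\times N}$, $\|T\|_{L_2(\pi)\to L_2(\pi)}=\max_{v:\|v\|_{L_2(\pi)}=1}\|Tv\|_{L_2(\pi)}$. The Schatten $\infty$-norm $\|M\|_{S_\infty}$ of a matrix $M$ is its largest singular value. If $\lambda\ge 1$, the quantity $\frac{C}{\sqrt{1-\lambda}}(\sigma+\sigma_*\sqrt{\log d})$ is read as $+\infty$, so that the minimum is $\|B\|_{S_\infty}$. ''Absolute'' means that $C$ does not depend on $d$, $B$, $\omega$, $f$, or the Markov chain. *)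

(* Defs.v *)
From HB Require Import structures.
From mathcomp Require Import all_boot all_order all_algebra.
From mathcomp Require Import all_classical all_reals all_analysis.

Set Implicit Arguments.
Unset Strict Implicit.
Unset Printing Implicit Defensive.

Import Order.TTheory GRing.Theory Num.Theory.
Import numFieldNormedType.Exports.

Local Open Scope classical_set_scope.
Local Open Scope ring_scope.

Definition row_stochastic (R : realType) (N : nat) (A : 'M[R]_N) : Prop :=
  (forall i j, 0 <= A i j) /\ (forall i, \sum_j A i j = 1).

Definition positive_distribution (R : realType) (N : nat) (pi : 'rV[R]_N) :
    Prop :=
  (forall i, 0 < pi 0 i) /\ \sum_i pi 0 i = 1.

Definition invariant_distribution (R : realType) (N : nat) (A : 'M[R]_N)
    (pi : 'rV[R]_N) : Prop :=
  forall j, \sum_i pi 0 i * A i j = pi 0 j.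

Definition averaging (R : realType) (N : nat) (pi : 'rV[R]_N) : 'M[R]_N :=
  \matrix_(i, j) pi 0 j.

Definition L2norm (R : realType) (N : nat) (pi : 'rV[R]_N) (v : 'cV[R]_N) : R :=
  Num.sqrt (\sum_i pi 0 i * `|v i 0| ^+ 2).

(* For positive pi and N > 0 the unit sphere is nonempty and compact, so that
   the supremum is a maximum. *)
Definition L2opnorm (R : realType) (N : nat) (pi : 'rV[R]_N) (M : 'M[R]_N) : R :=
  sup [set L2norm pi (M *m v) | v in [set v | L2norm pi v = 1]].

(* The eigenvalues of M^T M are nonnegative reals, so no eigenvalue is
   truncated by Num.sqrt. *)
Definition singular_values (R : realType) (m n : nat) (M : 'M[R]_(m, n)) :
    set R :=
  [set Num.sqrt a | a in [set a | eigenvalue (M^T *m M) a]].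

(* The set is finite, and nonempty for n > 0: the supremum is a maximum. *)
Definition schatten_infty (R : realType) (m n : nat) (M : 'M[R]_(m, n)) : R :=
  sup (singular_values M).

(* Time is counted from 0: Y k is the state at the (k+1)-st step. *)
Definition history (T : Type) (N : nat) (Y : nat -> T -> 'I_N)
    (s : nat -> 'I_N) (n : nat) : set T :=
  [set t | forall k, (k <= n)%N -> Y k t = s k].

Definition cond_prob (disp : measure_display) (T : measurableType disp)
    (R : realType) (P : probability T R) (F H : set T) : R :=
  fine (P (F `&` H)) / fine (P H).

Definition markov_chain (disp : measure_display) (T : measurableType disp)
    (R : realType) (P : probability T R) (N : nat) (A : 'M[R]_N)
    (Y : nat -> T -> 'I_N) : Prop :=
  (forall k i, measurable (Y k @^-1` [set i])) /\
  (forall (n : nat) (s : nat -> 'I_N), P (history Y s n) != 0%E ->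
     cond_prob P (Y n.+1 @^-1` [set s n.+1]) (history Y s n)
       = A (s n) (s n.+1)).

Definition stationary_markov_chain (disp : measure_display)
    (T : measurableType disp) (R : realType) (P : probability T R) (N : nat)
    (A : 'M[R]_N) (pi : 'rV[R]_N) (Y : nat -> T -> 'I_N) : Prop :=
  [/\ row_stochastic A, positive_distribution pi, invariant_distribution A pi,
      markov_chain P A Y &
      forall i, P (Y 0%N @^-1` [set i]) = (pi 0 i)%:E].

Definition upper_pairs (d : nat) : {set 'I_d * 'I_d} :=
  [set p : 'I_d * 'I_d | (p.1 <= p.2)%N]%SET.

(* Only the values of omega on upper_pairs d are used. *)
Definition chain_matrix (R : realType) (T : Type) (N d m : nat)
    (Y : nat -> T -> 'I_N) (f : 'I_N -> R) (B : 'M[R]_d)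
    (omega : 'I_d * 'I_d -> 'I_m) (t : T) : 'M[R]_d :=
  \matrix_(i, j)
    if (i, j) \in upper_pairs d then f (Y (omega (i, j)) t) * B i j
    else f (Y (omega (j, i)) t) * B j i.

Definition max_row_norm (R : realType) (d : nat) (B : 'M[R]_d) : R :=
  \big[Num.max/0]_i Num.sqrt (\sum_j B i j ^+ 2).

Definition max_entry (R : realType) (d : nat) (B : 'M[R]_d) : R :=
  \big[Num.max/0]_i \big[Num.max/0]_j `|B i j|.

(* The case distinction is needed because x / 0 = 0 and Num.sqrt x = 0 for
   x <= 0. *)
Definition spectral_gap_bound (R : realType) (C lambda : R) (d : nat)
    (B : 'M[R]_d) : \bar R :=
  if lambda < 1 then
    (C / Num.sqrt (1 - lambda)
       * (max_row_norm B + max_entry B * Num.sqrt (ln d%:R)))%:E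
  else +oo%E.

(* Main.v *)
Require Import Defs.
From HB Require Import structures.
From mathcomp Require Import all_boot all_order all_algebra.
From mathcomp Require Import all_classical all_reals all_analysis.
From mathcomp Require Import measurable_realfun zify ring lra.

(** The norm of a symmetric matrix M is at most the 2p-th root of tr M^2p, and
    a trace moment is a sum over closed walks. By Jensen the chain Y may be
    replaced by the pair (Y, Y') of independent copies, with the entries xi_k
    = f(Y_k) - f(Y'_k). These are antisymmetric under exchange of the copies,
    so between the (2i+1)-st and the (2i+2)-nd factor of a time-ordered
    product of xi's the transition operator acts on antisymmetric functions,
    which have mean zero; there it contracts L2 by mu = sqrt ((1 + lambda^2) /
    2). Hence the mixed moment with times k_1 <= ... <= k_2p is at most 4^p
    mu^((k_2 - k_1) + (k_4 - k_3) + ...).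

    Up to the factor 4^p, this is dominated by the corresponding moment of the
    moving average W_k = al sum_s mu^s eps_(k+s) of independent signs eps,
    when al is of order sqrt (1 - mu): expanding the product, the terms
    pairing the factors in consecutive order already give the bound and all
    others are nonnegative. As the entries of B are nonnegative, the
    domination passes to trace moments. Since W is a combination, with weights
    of total mass O(1 / sqrt (1 - mu)), of shifts of eps, convexity reduces
    the theorem to independent signs.

    For independent signs we follow Bandeira and van Handel. Normalise so that
    sigma_* = 1 and take p of order sigma^2 + log d. A walk contributes only
    if it uses every edge evenly often. Explore it step by step: a step to a
    new vertex uses an edge that is traversed at least twice, so it costs b^2,
    which sums to at most sigma^2 <= p; an unweighted walk on 4p vertices has
    at least p choices for a new vertex. Thus the trace moment is at most d
    times a moment of the norm of a 4p x 4p sign matrix, and the latter is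
    controlled by a union bound over integer vectors of squared length at most
    16p. *)

Set Implicit Arguments.
Unset Strict Implicit.
Unset Printing Implicit Defensive.

Import Order.TTheory GRing.Theory Num.Theory.
Import numFieldNormedType.Exports.

Local Open Scope classical_set_scope.
Local Open Scope ring_scope.

(** * Walks and random signs *)

Lemma big_tuple0 (V : nmodType) (T : finType) (F : seq T -> V) :
  \sum_(w : 0.-tuple T) F w = F [::].
Proof.
rewrite (eq_bigr (fun=> F [::])) => [|w _]; last by rewrite tuple0.
by rewrite sumr_const card_tuple expn0.
Qed.

Lemma big_tuple_cons (V : nmodType) (T : finType) n (F : seq T -> V) :
  \sum_(w : n.+1.-tuple T) F w = \sum_x \sum_(w : n.-tuple T) F (x :: w).
Proof.
rewrite pair_big /=.
rewrite (reindex (fun p : T * n.-tuple T => cons_tuple p.1 p.2)) //=.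
exists (fun w : n.+1.-tuple T => (thead w, behead_tuple w)) => [[x w] _|w _] /=.
  by congr pair; apply: val_inj.
by apply: val_inj; case: w => -[|x w].
Qed.

Lemma prod_count (R : comPzSemiRingType) (K : finType) (c : K -> R) (s : seq K) :
  \prod_(k <- s) c k = \prod_k c k ^+ count_mem k s.
Proof.
elim: s => [|x s IHs]; first by rewrite big_nil big1 // => k _; rewrite expr0.
rewrite big_cons IHs (bigD1 x) //= [RHS](bigD1 x) //= eqxx exprS mulrA.
congr (_ * _); apply: eq_bigr => k kx.
by rewrite eq_sym (negPf kx).
Qed.

Definition evens (K : eqType) (s : seq K) : bool :=
  all (fun k => ~~ odd (count_mem k s)) s.

Lemma evensP (K : eqType) (s : seq K) :
  reflect (forall k, ~~ odd (count_mem k s)) (evens s).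
Proof.
apply: (iffP allP) => [H k|H k _]; last exact: H.
have [/H //|/count_memPn -> //] := boolP (k \in s).
Qed.

Lemma evens_map (K L : eqType) (g : K -> L) (s : seq K) :
  {in s &, injective g} -> evens (map g s) = evens s.
Proof.
move=> gI; rewrite /evens all_map; apply: eq_in_all => k ks /=.
rewrite count_map; congr (~~ odd _); apply: eq_in_count => l ls /=.
by rewrite (inj_in_eq gI).
Qed.

(** An element of t occurs in s a positive even number of times, hence at least twice. The factors
    lie in [0, 1], so all further ones may be dropped. *)
Lemma prod_ge_dup (R : realDomainType) (K : finType) (c : K -> R)
    (s t : seq K) :
  (forall k, 0 <= c k <= 1) -> evens s -> uniq t -> {subset t <= s} ->
  \prod_(k <- s) c k <= \prod_(k <- t) c k ^+ 2.
Proof.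
move=> c01 /evensP es ut ts.
rewrite (prod_count c s) (prod_count (fun k => c k ^+ 2) t).
apply: ler_prod => k _; have /andP[c0 c1] := c01 k.
rewrite exprn_ge0 //= -exprM ler_wiXn2l //.
have [kt|] := boolP (k \in t); last by move=> /count_memPn ->.
rewrite count_uniq_mem // kt; have := es k.
have : (0 < count_mem k s)%N by rewrite -has_count has_pred1 ts.
by case: (count_mem k s) => [|[|m]].
Qed.

Section Signs.
Variable R : comPzRingType.

Definition sgn (b : bool) : R := (-1) ^+ b.

Lemma sgn_sqr b : sgn b * sgn b = 1.
Proof. by case: b; rewrite /sgn /= ?expr0 ?expr1 ?mulrNN mulr1. Qed.

(** The sum factorises over the coordinates. A coordinate used an odd number of times contributes 1
    - 1 = 0, any other contributes 2. *)
Lemma sum_sgn_prod (K : finType) (s : seq K) :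
  \sum_(e : {ffun K -> bool}) \prod_(k <- s) sgn (e k) =
  (#|{: {ffun K -> bool}}| * evens s)%:R.
Proof.
rewrite (eq_bigr (fun e : {ffun K -> bool} =>
  \prod_k sgn (e k) ^+ count_mem k s)) => [|e _]; last exact: prod_count.
rewrite -(bigA_distr_bigA (fun k b => sgn b ^+ count_mem k s)).
rewrite (eq_bigr (fun k => (2 * ~~ odd (count_mem k s))%:R)) => [|k _].
  rewrite -natr_prod big_split /= prod_nat_const card_ffun card_bool.
  congr (_ * _)%:R; have [/evensP es|] := boolP (evens s).
    by rewrite big1 // => k _; rewrite es.
  case/allPn => k ks /negbNE ok; rewrite (bigD1 k) //= ok //.
rewrite big_bool /sgn expr0 expr1 expr1n -(signr_odd _ (count_mem k s)).
by case: (odd _); rewrite ?muln0 ?muln1 /= ?expr0 ?expr1 ?addNr.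
Qed.

End Signs.

Section Walks.
Variable R : comPzRingType.

Fixpoint wprod d (M : 'M[R]_d) i w :=
  if w is j :: w' then M i j * wprod M j w' else 1.

Lemma expmx_walks d (M : 'M[R]_d) q i j :
  (M ^+ q) i j = \sum_(w : q.-tuple 'I_d) wprod M i w * (last i w == j)%:R.
Proof.
pose F i w := wprod M i w * (last i w == j)%:R.
elim: q i => [|q IHq] i.
  by rewrite (big_tuple0 (F i)) /F /= expr0 mxE mul1r.
rewrite exprS mxE (big_tuple_cons _ (F i)).
apply: eq_bigr => k _; rewrite IHq big_distrr /=.
by apply: eq_bigr => w _; rewrite mulrA.
Qed.

End Walks.

(* The sorted pair key i j encodes the edge {i, j}. *)
Definition key d (i j : 'I_d) : 'I_d * 'I_d :=
  if (i <= j)%N then (i, j) else (j, i).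

(** One variable per edge, scaled by the entries of b. Both the chain matrix and the sign matrices
    are of this form, so one expansion over walks serves for all. *)
Definition kmx (R : comPzRingType) d (b : 'M[R]_d) (x : 'I_d * 'I_d -> R) : 'M[R]_d :=
  \matrix_(i, j) (x (key i j) * b i j).

Fixpoint keys d (i : 'I_d) w :=
  if w is j :: w' then key i j :: keys j w' else [::].

Lemma wprod_kmx (R : comPzRingType) d (b : 'M[R]_d) x i w :
  wprod (kmx b x) i w = (\prod_(k <- keys i w) x k) * wprod b i w.
Proof.
elim: w i => [|j w IHw] i /=; first by rewrite big_nil mul1r.
by rewrite big_cons mxE IHw mulrACA.
Qed.

Lemma size_keys d (i : 'I_d) w : size (keys i w) = size w.
Proof. by elim: w i => //= j w IHw i; rewrite IHw. Qed.

Definition upper d := [pred k : 'I_d * 'I_d | (k.1 <= k.2)%N].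

Lemma keyC d (i j : 'I_d) : key i j = key j i.
Proof.
by rewrite /key; case: (ssrnat.ltngtP i j) => [||/val_inj ->].
Qed.

Lemma key_upper d (i j : 'I_d) : ((key i j).1 <= (key i j).2)%N.
Proof. by rewrite /key; case: (ssrnat.leqP i j) => [|/ltnW]. Qed.

Lemma keys_upper d (i : 'I_d) w k : k \in keys i w -> (k.1 <= k.2)%N.
Proof.
elim: w i => //= j w IHw i; rewrite inE => /orP[/eqP ->|/IHw //].
exact: key_upper.
Qed.

Lemma key_id d (k : 'I_d * 'I_d) : (k.1 <= k.2)%N -> key k.1 k.2 = k.
Proof. by case: k => i j /= ij; rewrite /key ij. Qed.

Lemma key_cases d (i j : 'I_d) : key i j = (i, j) \/ key i j = (j, i).
Proof. by rewrite /key; case: ifP; [left|right]. Qed.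

Lemma kmx_sym (R : comPzRingType) d (b : 'M[R]_d) x :
  b^T = b -> (kmx b x)^T = kmx b x.
Proof.
by move=> bT; apply/matrixP => i j; rewrite !mxE keyC -[in RHS]bT mxE.
Qed.

(** * Comparison of weighted walks with unweighted walks on fewer vertices *)

Section Exploration.
Variables (R : realFieldType) (d : nat) (b : 'M[R]_d).

(* h lists the vertices visited so far, i is the current one, w is the rest of
   the walk. *)
Fixpoint dweight (h : seq 'I_d) i w : R :=
  if w is j :: w' then
    (if j \in h then 1 else b i j ^+ 2) * dweight (j :: h) j w'
  else 1.

Fixpoint dkeys (h : seq 'I_d) i w : seq ('I_d * 'I_d) :=
  if w is j :: w' then
    if j \in h then dkeys (j :: h) j w' else key i j :: dkeys (j :: h) j w'
  else [::].

Hypothesis bT : b^T = b.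

Lemma sym_key i j : b (key i j).1 (key i j).2 = b i j.
Proof. by case: (key_cases i j) => -> //=; rewrite -{1}bT mxE. Qed.

Lemma wprod_keys i w : wprod b i w = \prod_(k <- keys i w) b k.1 k.2.
Proof.
elim: w i => [|j w IHw] i /=; first by rewrite big_nil.
by rewrite big_cons IHw sym_key.
Qed.

Lemma dweight_dkeys h i w :
  dweight h i w = \prod_(k <- dkeys h i w) b k.1 k.2 ^+ 2.
Proof.
elim: w h i => [|j w IHw] h i /=; first by rewrite big_nil.
by case: ifP => _; rewrite ?big_cons IHw ?mul1r // sym_key.
Qed.

Lemma dkeys_sub h i w : {subset dkeys h i w <= keys i w}.
Proof.
elim: w h i => [|j w IHw] h i k //=; rewrite [in X in _ -> X]inE.
case: ifP => _; first by move=> /IHw ->; rewrite orbT.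
by rewrite inE => /orP[->//|/IHw ->]; rewrite orbT.
Qed.

Lemma dkeys_new h i w k :
  k \in dkeys h i w -> (k.1 \notin h) || (k.2 \notin h).
Proof.
elim: w h i => [|j w IHw] h i //=.
have step : k \in dkeys (j :: h) j w -> (k.1 \notin h) || (k.2 \notin h).
  by move=> /IHw; rewrite !inE !negb_or => /orP[]/andP[_ ->]; rewrite ?orbT.
case: ifP => // /negbT jh; rewrite inE => /orP[/eqP ->|//].
by case: (key_cases i j) => -> /=; rewrite jh ?orbT.
Qed.

(** Once an edge is recorded, both its endpoints belong to the history, whereas every edge recorded
    later has an endpoint outside it. *)
Lemma dkeys_uniq h i w : i \in h -> uniq (dkeys h i w).
Proof.
elim: w h i => [|j w IHw] h i ih //=.
have jh' : j \in j :: h by rewrite mem_head.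
case: ifP => _ /=; rewrite IHw ?andbT //.
apply/negP => /dkeys_new; case: (key_cases i j) => -> /=;
  by rewrite !inE eqxx ih ?orbT.
Qed.

(* In a walk using every edge an even number of times, the edges
   leading to new vertices are used at least twice. *)
Lemma wprod_le_dweight i w : (forall i j, 0 <= b i j <= 1) ->
  evens (keys i w) -> wprod b i w <= dweight [:: i] i w.
Proof.
move=> b01 ev; rewrite wprod_keys dweight_dkeys.
apply: (prod_ge_dup (c := fun k => b k.1 k.2)) => //.
  by apply: dkeys_uniq; rewrite mem_head.
exact: dkeys_sub.
Qed.

End Exploration.

Section Comparison.
Variables (R : realFieldType) (d r : nat) (b : 'M[R]_d) (i0 : 'I_d) (v0 : 'I_r).

(** The list ks holds the edges traversed before reaching i, so that evenness is required of the
    walk as a whole and not of its remainder only. *)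
Definition explore q h i (ks : seq ('I_d * 'I_d)) : R :=
  \sum_(w : q.-tuple 'I_d)
    dweight b h i w * (evens (ks ++ keys i w) && (last i w == i0))%:R.

Definition count_walks q v (ks : seq ('I_r * 'I_r)) : R :=
  \sum_(w : q.-tuple 'I_r) (evens (ks ++ keys v w) && (last v w == v0))%:R.

Lemma exploreS q h i ks : explore q.+1 h i ks =
  \sum_j (if j \in h then 1 else b i j ^+ 2)
    * explore q (j :: h) j (rcons ks (key i j)).
Proof.
rewrite /explore (big_tuple_cons _ (fun w => dweight b h i w *
  (evens (ks ++ keys i w) && (last i w == i0))%:R)).
apply: eq_bigr => j _ /=; rewrite big_distrr /=.
by apply: eq_bigr => w _; rewrite cat_rcons mulrA.
Qed.

Lemma count_walksS q v ks : count_walks q.+1 v ks =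
  \sum_u count_walks q u (rcons ks (key v u)).
Proof.
rewrite /count_walks (big_tuple_cons _ (fun w =>
  (evens (ks ++ keys v w) && (last v w == v0))%:R)).
by apply: eq_bigr => u _; apply: eq_bigr => w _; rewrite cat_rcons.
Qed.

Lemma count_walks_ge0 q v ks : 0 <= count_walks q v ks.
Proof. by apply: sumr_ge0 => w _; rewrite ler0n. Qed.

Let map_key (phi : 'I_d -> 'I_r) (k : 'I_d * 'I_d) :=
  key (phi k.1) (phi k.2).

Lemma map_key_key phi i j : map_key phi (key i j) = key (phi i) (phi j).
Proof. by rewrite /map_key; case: (key_cases i j) => -> //=; rewrite keyC. Qed.

(** Relabelling may reverse a pair. If two images agree with crossed endpoints, the original pairs
    still coincide because both are sorted. This is what lets [evens] survive relabelling. *)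
Lemma map_key_inj (phi : 'I_d -> 'I_r) (h : seq 'I_d) (ks : seq ('I_d * 'I_d)) :
  {in h &, injective phi} ->
  (forall k, k \in ks -> [&& k.1 \in h, k.2 \in h & (k.1 <= k.2)%N]) ->
  {in ks &, injective (map_key phi)}.
Proof.
move=> phiI ksh k l /ksh/and3P[k1 k2 kk] /ksh/and3P[l1 l2 ll].
case: k k1 k2 kk => k1 k2 /= h1 h2 kk.
case: l l1 l2 ll => l1 l2 /= h3 h4 ll.
have [] := key_cases (phi k1) (phi k2); have [] := key_cases (phi l1) (phi l2);
  rewrite /map_key /= => -> -> [] /phiI E1 /phiI E2.
- by rewrite (E1 h1 h3) (E2 h2 h4).
- have {}E1 := E1 h1 h4; have {}E2 := E2 h2 h3; subst.
  by congr pair; apply: val_inj => /=; lia.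
- have {}E1 := E1 h2 h3; have {}E2 := E2 h1 h4; subst.
  by congr pair; apply: val_inj => /=; lia.
- by rewrite (E1 h2 h4) (E2 h1 h3).
Qed.

Variable s : nat.
Hypothesis rowb : forall i, \sum_j b i j ^+ 2 <= s%:R.

(* Relabelling the visited vertices by phi preserves the pattern of
   coincidences of a walk. A step to a new vertex has total weight at most s
   on the left, and at least r - size h >= s choices on the right. *)
Lemma explore_le (phi : 'I_d -> 'I_r) q h i ks :
  (size h + q + s <= r)%N -> i \in h -> i0 \in h ->
  {in h &, injective phi} -> phi i0 = v0 ->
  (forall k, k \in ks -> [&& k.1 \in h, k.2 \in h & (k.1 <= k.2)%N]) ->
  explore q h i ks <= count_walks q (phi i) (map (map_key phi) ks).
Proof.
elim: q phi h i ks => [|q IHq] phi h i ks hq ih i0h phiI phi0 ksh.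
  rewrite /explore (big_tuple0 (fun w => dweight b h i w *
    (evens (ks ++ keys i w) && (last i w == i0))%:R)) /= mul1r.
  rewrite /count_walks (big_tuple0 (fun w =>
    (evens (map (map_key phi) ks ++ keys (phi i) w) && (last (phi i) w == v0))%:R)) /=.
  rewrite !cats0 evens_map; last exact: map_key_inj phiI ksh.
  by rewrite -phi0 (inj_in_eq phiI).
rewrite exploreS count_walksS.
rewrite (bigID (mem h)) [X in _ <= X](bigID (mem (map phi h))) /=.
apply: lerD.
  pose img := [set phi j | j in mem h]%SET.
  rewrite (eq_bigl (mem img)); last first.
    move=> u; apply/mapP/imsetP => -[j jh ->]; by exists j.
  rewrite [X in _ <= X]big_imset /=; last by move=> x y; apply: phiI.
  apply: ler_sum => j jh; rewrite jh mul1r.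
  have -> : key (phi i) (phi j) = map_key phi (key i j) by rewrite map_key_key.
  rewrite -map_rcons.
  (* The weight depends only on the set of visited vertices. Hence a return to an old vertex need
     not lengthen h, and the bound on its size is kept. *)
  have -> : explore q (j :: h) j (rcons ks (key i j)) =
      explore q h j (rcons ks (key i j)).
    rewrite /explore; apply: eq_bigr => w _; congr (_ * _).
    have : j :: h =i h by move=> x; rewrite inE; case: eqP => // ->.
    move: (j :: h) => h1.
    elim: (tval w) h1 h j {IHq hq ih i0h phiI jh ksh img} => //= x {}w IH h1 h j hh.
    by rewrite hh; congr (_ * _); apply: IH => y; rewrite !inE hh.
  apply: IHq => //; first by apply: leq_trans hq; rewrite !leq_add2r leq_add2l.
  move=> k; rewrite mem_rcons inE => /orP[/eqP ->|/ksh //].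
  by rewrite key_upper; case: (key_cases i j) => -> /=; rewrite ih jh.
set new := [pred u | u \notin map phi h].
have card_new : (s <= #|new|)%N.
  have c1 := card_size (map phi h); rewrite size_map in c1.
  have c2 : (#|map phi h| + #|[predC map phi h]| = r)%N.
    by rewrite -[RHS]card_ord; exact: cardC.
  have c3 : #|[predC map phi h]| = #|new| by apply: eq_card => u; rewrite !inE.
  rewrite -(leq_add2l (size h)); apply: (@leq_trans r); first by move: hq; lia.
  by rewrite -[X in (X <= _)%N]c2 c3 leq_add2r.
pose F u := count_walks q u (rcons (map (map_key phi) ks) (key (phi i) u)).
(* Any free label u may serve as the image of the new vertex j: the relabelling phi is extended by
   sending j to u. *)
have main j : j \notin h -> forall u, u \in new ->
    explore q (j :: h) j (rcons ks (key i j)) <= F u.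
  move=> jh u un; pose psi x := if x == j then u else phi x.
  have psij : psi j = u by rewrite /psi eqxx.
  have psih x : x \in h -> psi x = phi x.
    by rewrite /psi; case: eqP => // -> H; rewrite H in jh.
  have -> : F u = count_walks q (psi j) (map (map_key psi) (rcons ks (key i j))).
    rewrite /F map_rcons map_key_key psij psih //; congr (count_walks _ _ (rcons _ _)).
    by apply/eq_in_map => k /ksh/and3P[k1 k2 _]; rewrite /map_key !psih.
  apply: IHq.
  - by move: hq => /=; lia.
  - exact: mem_head.
  - by rewrite inE i0h orbT.
  - move=> x y; rewrite !inE => /predU1P[->|xh] /predU1P[->|yh] //.
    + rewrite psij psih // => E; move: un; rewrite inE E.
      by rewrite map_f.
    + rewrite psij psih // => E; move: un; rewrite inE -E.
      by rewrite map_f.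
    + by rewrite !psih //; apply: phiI.
  - by rewrite psih.
  - move=> k; rewrite mem_rcons inE => /predU1P[->|/ksh/and3P[k1 k2 k12]].
      by rewrite key_upper; case: (key_cases i j) => -> /=; rewrite !inE eqxx ih ?orbT.
    by rewrite !inE k1 k2 k12 !orbT.
pose S := \sum_(u in new) F u.
have S0 : 0 <= S by apply: sumr_ge0 => u _; apply: count_walks_ge0.
(* Summing the previous bound over all free labels gains the factor #|new| >= s, which pays for the
   weights b i j ^+ 2. *)
have le_S j : j \notin h ->
    explore q (j :: h) j (rcons ks (key i j)) * #|new|%:R <= S.
  move=> jh; rewrite -sum1_card natr_sum big_distrr /=.
  by apply: ler_sum => u un; rewrite mulr1; apply: main.
rewrite -/S (eq_bigr (fun j => b i j ^+ 2 *
  explore q (j :: h) j (rcons ks (key i j)))) => [|j /negPf -> //].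
have row_new : \sum_(j | j \notin h) b i j ^+ 2 <= s%:R.
  apply: le_trans (rowb i); rewrite [X in _ <= X](bigID (mem h)) /=.
  by rewrite lerDr; apply: sumr_ge0 => j _; rewrite sqr_ge0.
(* Without free labels s = 0, and the row bound makes every weight of a step to a new vertex
   vanish. *)
have [new0|new_gt0] := posnP #|new|.
  rewrite big1 // => j jh; suff -> : b i j ^+ 2 = 0 by rewrite mul0r.
  have /psumr_eq0P -> // : \sum_(j | j \notin h) b i j ^+ 2 = 0.
    apply/le_anti; rewrite sumr_ge0 ?andbT => [|k _]; last exact: sqr_ge0.
    by apply: le_trans row_new _; move: card_new; rewrite new0 leqn0 => /eqP ->.
  by move=> k _; apply: sqr_ge0.
rewrite -(@ler_pM2r _ #|new|%:R) ?ltr0n // big_distrl /=.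
apply: (@le_trans _ _ (\sum_(j | j \notin h) b i j ^+ 2 * S)).
  by apply: ler_sum => j jh; rewrite -mulrA ler_wpM2l ?sqr_ge0 // le_S.
rewrite -big_distrl /= mulrC ler_wpM2l //.
by apply: le_trans row_new _; rewrite ler_nat.
Qed.

End Comparison.

Section RandomSigns.
Variables (R : realFieldType) (K : finType).

(** As iota is injective on sorted pairs, the signs met along a walk have the same multiplicities as
    its edges. *)
Lemma sum_sgn_walks d (b : 'M[R]_d) (iota : 'I_d * 'I_d -> K) q i j :
  {in upper d &, injective iota} ->
  \sum_(e : {ffun K -> bool})
    ((kmx b (fun k => sgn R (e (iota k)))) ^+ q) i j =
  #|{: {ffun K -> bool}}|%:R *
    \sum_(w : q.-tuple 'I_d)
      wprod b i w * (evens (keys i w) && (last i w == j))%:R.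
Proof.
move=> iotaI; under eq_bigr do rewrite expmx_walks.
rewrite exchange_big big_distrr; apply: eq_bigr => w _ /=.
rewrite -(evens_map (g := iota)); last first.
  by move=> k l /keys_upper kk /keys_upper ll; apply: iotaI.
have := sum_sgn_prod R (map iota (keys i w)); rewrite natrM => /esym E.
rewrite -mulnb natrM mulrCA mulrA mulrA -(mulrA (wprod b i w)) E.
rewrite -mulrA big_distrl big_distrr /=; apply: eq_bigr => e _.
by rewrite wprod_kmx big_map mulrA [wprod _ _ _ * _]mulrC.
Qed.

End RandomSigns.

(** For each of the d starting points the exploration begins with a single visited vertex, which is
    relabelled v0. *)
Lemma sum_sgn_trace_le (R : realFieldType) (K : finType) d r (b : 'M[R]_d)
    (iota : 'I_d * 'I_d -> K) q (v0 : 'I_r) :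
  b^T = b -> (forall i j, 0 <= b i j <= 1) ->
  {in upper d &, injective iota} ->
  forall s, (forall i, \sum_j b i j ^+ 2 <= s%:R) -> (1 + q + s <= r)%N ->
  \sum_(e : {ffun K -> bool}) \tr ((kmx b (fun k => sgn R (e (iota k)))) ^+ q) <=
  (#|{: {ffun K -> bool}}| * d)%:R * count_walks R v0 q v0 [::].
Proof.
move=> bT b01 iotaI s rowb hr; rewrite exchange_big /=.
rewrite (eq_bigr (fun i => #|{: {ffun K -> bool}}|%:R *
    \sum_(w : q.-tuple 'I_d) wprod b i w * (evens (keys i w) && (last i w == i))%:R));
  last by move=> i _; apply: sum_sgn_walks.
rewrite -big_distrr natrM -mulrA.
rewrite ler_wpM2l ?ler0n //=.
rewrite mulr_natl -[d in _ *+ d]card_ord -sumr_const; apply: ler_sum => i _.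
have := @explore_le R d r b i v0 s rowb (fun=> v0) q [:: i] i [::] hr.
rewrite mem_head /= => /(_ isT isT) H.
apply: le_trans (H _ _ _) => //; last by move=> x y; rewrite !inE => /eqP -> /eqP ->.
rewrite /explore; apply: ler_sum => w _; rewrite cat0s.
case: (boolP (evens _)) => [ev|_] /=; last by rewrite !mulr0.
by rewrite ler_wpM2r ?ler0n // wprod_le_dweight.
Qed.

(** Read from right to left, this turns the number of walks back into a moment of the r x r sign
    matrix, which the net argument below controls. *)
Lemma count_walks_sgn (R : realFieldType) r (v0 : 'I_r) q :
  \sum_(e : {ffun 'I_r * 'I_r -> bool})
    ((kmx (const_mx 1) (fun k => sgn R (e k))) ^+ q) v0 v0 =
  #|{: {ffun 'I_r * 'I_r -> bool}}|%:R * count_walks R v0 q v0 [::].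
Proof.
rewrite (@sum_sgn_walks R _ r (const_mx 1) id) // /count_walks.
congr (_ * _); apply: eq_bigr => w _; rewrite cat0s.
suff -> : forall i, wprod (const_mx 1 : 'M[R]_r) i w = 1 by rewrite mul1r.
by elim: (tval w) => //= j {}w IHw i; rewrite mxE mul1r IHw.
Qed.

(** * Moments of Rademacher sums *)

Section SquareNorm.
Variables (R : realFieldType).

Definition sqn d (v : 'rV[R]_d) := \sum_j v 0 j ^+ 2.

Lemma sqn_ge0 d (v : 'rV[R]_d) : 0 <= sqn v.
Proof. by apply: sumr_ge0 => j _; apply: sqr_ge0. Qed.

Lemma sqnE d (v : 'rV[R]_d) : sqn v = (v *m v^T) 0 0.
Proof. by rewrite mxE; apply: eq_bigr => j _; rewrite mxE expr2. Qed.

Lemma sqn0_eq0 d (v : 'rV[R]_d) : sqn v = 0 -> v = 0.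
Proof.
move=> /psumr_eq0P v0; apply/rowP => j; rewrite mxE; apply/eqP.
by rewrite -sqrf_eq0 v0 // => k _; apply: sqr_ge0.
Qed.

Lemma sqnZ d a (v : 'rV[R]_d) : sqn (a *: v) = a ^+ 2 * sqn v.
Proof. by rewrite big_distrr; apply: eq_bigr => j _; rewrite mxE exprMn. Qed.

Lemma trmx_exp d (M : 'M[R]_d) q : M^T = M -> (M ^+ q)^T = M ^+ q.
Proof.
move=> MT; elim: q => [|q IHq]; first by rewrite expr0 trmx1.
by rewrite {1}exprS trmx_mul IHq MT exprSr.
Qed.

Lemma sqn_exp_le d (M : 'M[R]_d) c q v :
  0 <= c -> (forall v, sqn (v *m M) <= c * sqn v) ->
  sqn (v *m M ^+ q) <= c ^+ q * sqn v.
Proof.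
move=> c0 Mc; elim: q v => [|q IHq] v; first by rewrite !expr0 mulmx1 mul1r.
rewrite exprS mulmxA; apply: le_trans (IHq _) _.
by rewrite exprSr -mulrA ler_wpM2l ?exprn_ge0.
Qed.

Lemma diag_exp_double d (M : 'M[R]_d) q i :
  M^T = M -> (M ^+ (q * 2)) i i = sqn (row i (M ^+ q)).
Proof.
move=> MT; rewrite exprM expr2 mxE; apply: eq_bigr => j _.
by rewrite mxE -{2}(trmx_exp q MT) mxE expr2.
Qed.

Lemma sqn_delta d (i : 'I_d) : sqn (delta_mx 0 i) = 1.
Proof.
rewrite /sqn (bigD1 i) //= mxE !eqxx expr1n big1 ?addr0 // => j ji.
by rewrite mxE (negPf ji) expr0n.
Qed.

Lemma diag_exp_le d (M : 'M[R]_d) c q i :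
  M^T = M -> 0 <= c -> (forall v, sqn (v *m M) <= c * sqn v) ->
  (M ^+ (q * 2)) i i <= c ^+ q.
Proof.
move=> MT c0 Mc; rewrite diag_exp_double // rowE.
by apply: le_trans (sqn_exp_le _ _ c0 Mc) _; rewrite sqn_delta mulr1.
Qed.

End SquareNorm.

Section Khintchine.
Variables (R : realFieldType) (K : finType) (a : K -> R).
Let E := {ffun K -> bool}.

Definition rsum (e : E) := \sum_k a k * sgn R (e k).

Let flip k (e : E) : E := [ffun l => if l == k then ~~ e l else e l].

Let flipK k : involutive (flip k).
Proof.
by move=> e; apply/ffunP => l; rewrite !ffunE; case: eqP; rewrite ?negbK.
Qed.

Let rsum_flip k e : rsum e - rsum (flip k e) = 2 * (a k * sgn R (e k)).
Proof.
rewrite /rsum (bigD1 k) //= [X in _ - X](bigD1 k) //= ffunE eqxx.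
rewrite [X in _ - (_ + X)](eq_bigr (fun l => a l * sgn R (e l))) =>
  [|l /negPf lk]; last first.
  by rewrite /flip ffunE lk.
have -> : sgn R (~~ e k) = - sgn R (e k).
  by case: (e k); rewrite /sgn /= ?expr0 ?expr1 ?opprK.
by rewrite mulrN; ring.
Qed.

Lemma ler_mono_mixed (x y : R) m i : ~~ odd m -> (i <= m)%N ->
  x ^+ (m - i) * y ^+ i <= x ^+ m + y ^+ m.
Proof.
move=> em im; apply: le_trans (ler_norm _) _; rewrite normrM !normrX.
have abs_even (z : R) : `|z| ^+ m = z ^+ m.
  by rewrite -normrX ger0_norm // exprn_even_ge0.
rewrite -(abs_even x) -(abs_even y).
have [xy|/ltW yx] := leP `|x| `|y|.
  apply: le_trans (_ : `|y| ^+ m <= _); last by rewrite lerDr exprn_ge0.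
  rewrite -{2}(subnK im) exprD ler_wpM2r ?exprn_ge0 //.
  by rewrite lerXn2r ?nnegrE.
apply: le_trans (_ : `|x| ^+ m <= _); last by rewrite lerDl exprn_ge0.
rewrite -{2}(subnK im) exprD ler_wpM2l ?exprn_ge0 //.
by rewrite lerXn2r ?nnegrE.
Qed.

(** A discrete integration by parts. One factor of the power is expanded, and its k-th term is
    averaged with its image under the flip of the k-th sign. The difference of the two powers
    contains a second factor a k, and [ler_mono_mixed] bounds the n + 1 mixed monomials that remain;
    the constant is 2 (n + 1) <= 4 (q + 1). *)
Let khintchine_step q :
  \sum_(e : E) rsum e ^+ (q.+1 * 2) <=
  (4 * q.+1)%:R * (\sum_k a k ^+ 2) * \sum_(e : E) rsum e ^+ (q * 2).
Proof.
set n := (q * 2)%N; have -> : (q.+1 * 2 = n.+2)%N by rewrite /n mulSn.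
have n_even : ~~ odd n by rewrite /n oddM andbF.
have -> : \sum_(e : E) rsum e ^+ n.+2 =
    \sum_k \sum_(e : E) a k * sgn R (e k) * rsum e ^+ n.+1.
  rewrite exchange_big; apply: eq_bigr => e _ /=.
  by rewrite -big_distrl /= exprS.
rewrite -mulrA big_distrl big_distrr /=; apply: ler_sum => k _.
have flip_sum (F : E -> R) : \sum_(e : E) F (flip k e) = \sum_(e : E) F e.
  by rewrite [RHS](reindex_inj (inv_inj (flipK k))).
rewrite -(ler_pM2l (_ : 0 < 2 :> R)) //.
have -> : 2 * (\sum_(e : E) a k * sgn R (e k) * rsum e ^+ n.+1) =
    \sum_(e : E) a k * sgn R (e k) * (rsum e ^+ n.+1 - rsum (flip k e) ^+ n.+1).
  rewrite [RHS](eq_bigr (fun e : E => a k * sgn R (e k) * rsum e ^+ n.+1 +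
     a k * sgn R (flip k e k) * rsum (flip k e) ^+ n.+1)) => [|e _].
    rewrite big_split /= (flip_sum (fun e : E => a k * sgn R (e k) * rsum e ^+ n.+1)).
    by rewrite mulr_natl.
  rewrite /flip ffunE eqxx.
  by case: (e k); rewrite /sgn /= ?expr0 ?expr1; ring.
apply: (@le_trans _ _ (\sum_(e : E) 2 * (a k ^+ 2 * (n.+1%:R *
    (rsum e ^+ n + rsum (flip k e) ^+ n))))).
  apply: ler_sum => e _; rewrite subrXX rsum_flip.
  set s := sgn R (e k).
  have assoc (z : R) : a k * s * (2 * (a k * s) * z) = 2 * (a k ^+ 2 * ((s * s) * z)).
    by ring.
  rewrite assoc sgn_sqr mul1r ler_pM2l // ler_wpM2l ?sqr_ge0 //.
  rewrite mulr_natl -[X in _ *+ X]card_ord -sumr_const.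
  apply: ler_sum => i _ /=; apply: ler_mono_mixed => //.
  by rewrite -ltnS.
rewrite -big_distrr /= ler_pM2l // -big_distrr /= -big_distrr /= big_split /=.
rewrite (flip_sum (fun e : E => rsum e ^+ n)) [X in _ <= X]mulrCA ler_wpM2l ?sqr_ge0 //.
rewrite -mulr2n mulrnAr -mulrnAl ler_wpM2r //.
  by apply: sumr_ge0 => e _; rewrite exprn_even_ge0.
by rewrite -mulrnA ler_nat /n; lia.
Qed.

Lemma khintchine q : \sum_(e : E) rsum e ^+ (q * 2) <=
  #|{: E}|%:R * ((4 * q)%:R * \sum_k a k ^+ 2) ^+ q.
Proof.
set A := \sum_k a k ^+ 2; have A0 : 0 <= A by apply: sumr_ge0 => k _; apply: sqr_ge0.
(* The factors 4, 8, ..., 4 q of the successive steps are all replaced by the last one. *)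
suff H m : (m <= q)%N -> \sum_(e : E) rsum e ^+ (m * 2) <=
  #|{: E}|%:R * ((4 * q)%:R * A) ^+ m by apply: H.
elim: m => [|m IHm] mq.
  rewrite expr0 mulr1 mul0n (eq_bigr (fun=> 1)) => [|e _]; last by rewrite expr0.
  by rewrite sumr_const.
apply: le_trans (khintchine_step m) _.
rewrite exprS mulrCA; apply: ler_pM.
- by rewrite mulr_ge0.
- by apply: sumr_ge0 => e _; rewrite exprn_even_ge0 // oddM andbF.
- by rewrite ler_wpM2r // ler_nat leq_mul2l.
- by apply: IHm; apply: ltnW.
Qed.

End Khintchine.

(** * The sign matrix *)

Section SignMatrix.
Variables (R : realType) (r : nat).
(** Integer vectors, coded by signs and absolute values. Absolute values up to r + 1 suffice for
    rounding up the coordinates of a vector of squared length at most r. *)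
Let Z := {ffun 'I_r -> bool * 'I_r.+2}.

Definition zvec (t : Z) : 'rV[R]_r :=
  \row_i (sgn R (t i).1 * (nat_of_ord (t i).2)%:R).

(** The radius allows for rounding: (|x| + 1)^2 <= 2 x^2 + 2 in each coordinate, which sums to at
    most 4 r when [sqn x <= r]. *)
Definition net := [set t : Z | sqn (zvec t) <= (4 * r)%:R]%SET.

Lemma sqn_zvec t : sqn (zvec t) = (\sum_i (nat_of_ord (t i).2) ^ 2)%:R.
Proof.
rewrite natr_sum; apply: eq_bigr => i _.
by rewrite mxE exprMn expr2 sgn_sqr mul1r natrX.
Qed.

Lemma sum_half_le n : \sum_(m < n) (2^-1 : R) ^+ m <= 2.
Proof.
suff -> : \sum_(m < n) (2^-1 : R) ^+ m = 2 - 2 * 2^-1 ^+ n.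
  by rewrite gerBl mulr_ge0 // exprn_ge0 // invr_ge0.
elim: n => [|n IHn]; first by rewrite big_ord0 expr0; ring.
by rewrite big_ord_recr /= IHn exprS; field.
Qed.

(** Give t the weight of 2 to the power - sum_i |t_i|. On integers |t_i| <= t_i^2, so a vector of
    the net weighs at least 16^-r, while the total weight is a product of r factors, each at most 2
    * 2. *)
Lemma card_net : #|net|%:R <= 64 ^+ r :> R.
Proof.
pose h (p : bool * 'I_r.+2) : R := 2^-1 ^+ p.2.
have h_ge0 p : 0 <= h p by rewrite exprn_ge0 // invr_ge0.
apply: (@le_trans _ _ (16 ^+ r * \sum_(t : Z) \prod_i h (t i))).
  rewrite -sum1_card natr_sum big_distrr /= [X in _ <= X](bigID (mem net)) /=.
  rewrite -[X in X <= _]addr0; apply: lerD; last first.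
    by apply: sumr_ge0 => t _; rewrite mulr_ge0 ?exprn_ge0 // prodr_ge0.
  apply: ler_sum => t; rewrite inE sqn_zvec ler_nat => tn.
  rewrite /h prodrXr.
  have le4 : (\sum_i nat_of_ord (t i).2 <= 4 * r)%N.
    apply: leq_trans tn; apply: leq_sum => i _.
    by case: (nat_of_ord _) => // n; rewrite expnS leq_pmulr.
  have -> : (16 : R) = 2 ^+ 4 by rewrite -natrX.
  rewrite -exprM -(subnK le4) exprD -mulrA exprVn mulfV ?expf_neq0 // mulr1.
  by rewrite exprn_ege1 // ler1n.
rewrite -(bigA_distr_bigA (fun i p => h p)) prodr_const card_ord -exprMn.
rewrite lerXn2r ?nnegrE ?mulr_ge0 //; first exact: sumr_ge0.
have -> : (64 : R) = 16 * (2 * 2) by ring.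
rewrite ler_wpM2l // -(pair_bigA _ (fun s m => h (s, m))) /= big_bool /h /=.
by rewrite -mulr2n -[_ *+ 2]mulr_natl ler_wpM2l // sum_half_le.
Qed.

(* Rounding each |x i| up to an integer and giving it the sign of g i
   increases the scalar product with g. *)
Lemma net_round (x g : 'rV[R]_r) : sqn x <= r%:R ->
  exists2 t, t \in net & (x *m g^T) 0 0 <= (zvec t *m g^T) 0 0.
Proof.
move=> xr; have x_le i : `|x 0 i| <= r%:R.
  have r0 : (0 < r)%N by case: r i => [[]|].
  rewrite -(@ler_pXn2r _ 2) ?nnegrE // -normrX ger0_norm ?sqr_ge0 //.
  apply: le_trans (_ : r%:R <= _); last by rewrite -natrX ler_nat leq_pmulr.
  by apply: le_trans xr; rewrite /sqn (bigD1 i) //= lerDl sumr_ge0 // => j _; rewrite sqr_ge0.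
pose m i := (Num.truncn `|x 0 i|).+1.
have m_gt i : `|x 0 i| <= (m i)%:R by apply/ltW/truncnS_gt.
have m_le i : (m i)%:R <= `|x 0 i| + 1 by rewrite -natr1 lerD2r truncn_le.
have m_lt i : (m i < r.+2)%N.
  by rewrite !ltnS -(ler_nat R); apply: le_trans (x_le i); rewrite truncn_le.
exists [ffun i => (g 0 i < 0, Ordinal (m_lt i))].
  rewrite inE /sqn (eq_bigr (fun i => (m i)%:R ^+ 2)) => [|i _]; last first.
    by rewrite mxE ffunE /= exprMn expr2 sgn_sqr mul1r.
  apply: (@le_trans _ _ (\sum_i (2 * x 0 i ^+ 2 + 2))).
    apply: ler_sum => i _.
    have H : (m i)%:R ^+ 2 <= (`|x 0 i| + 1) ^+ 2 :> R.
      by rewrite ler_pXn2r ?nnegrE ?addr_ge0.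
    apply: le_trans H _.
    rewrite -[x 0 i ^+ 2]real_normK ?num_real //.
    by have := sqr_ge0 (`|x 0 i| - 1); lra.
  rewrite big_split /= -big_distrr /= sumr_const card_ord.
  by move: xr; rewrite -/(sqn x) natrM -mulr_natl; lra.
rewrite !mxE; apply: ler_sum => i _; rewrite !mxE ffunE /=.
apply: (@le_trans _ _ (`|x 0 i| * `|g 0 i|)); first by rewrite -normrM ler_norm.
have -> : sgn R (g 0 i < 0) * (m i)%:R * g 0 i = (m i)%:R * `|g 0 i|.
  have [g0|g0] := ltP (g 0 i) 0; rewrite /sgn ?expr0 ?expr1.
    by rewrite ltr0_norm //; ring.
  by rewrite ger0_norm //; ring.
by rewrite ler_wpM2r.
Qed.

(** Take for m the maximum of the form over pairs from the net. Rounding the two arguments one after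
    the other shows that it dominates the form on the ball, and its even power is one term of a sum
    of nonnegative terms. *)
Lemma net_max (Y : 'M[R]_r) q : Y^T = Y ->
  exists m, [/\ 0 <= m,
    (forall x y, sqn x <= r%:R -> sqn y <= r%:R -> (x *m Y *m y^T) 0 0 <= m) &
    m ^+ (q * 2) <= \sum_(s in net) \sum_(t in net)
      (zvec s *m Y *m (zvec t)^T) 0 0 ^+ (q * 2)].
Proof.
move=> YT; pose t0 : Z := [ffun=> (false, ord0)].
have z0 : zvec t0 = 0.
  by apply/rowP => i; rewrite !mxE ffunE /= mulr0.
have t0n : t0 \in net.
  by rewrite inE z0 /sqn big1 // => j _; rewrite mxE expr0n.
pose F (p : Z * Z) := (zvec p.1 *m Y *m (zvec p.2)^T) 0 0.
have Pt0 : ((t0, t0).1 \in net) && ((t0, t0).2 \in net) by rewrite /= t0n.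
have [[s t] /= /andP[sn tn] st_max] := arg_maxP F
  (P := [pred p : Z * Z | (p.1 \in net) && (p.2 \in net)]) Pt0.
exists (F (s, t)); split.
- have /= := st_max _ Pt0; rewrite {1}/F /= z0 !mul0mx mxE; exact.
- move=> x y xr yr.
  have [s' s'n s'x] := net_round (y *m Y) xr.
  have [t' t'n t'y] := net_round (zvec s' *m Y) yr.
  apply: (@le_trans _ _ (F (s', t'))); last by apply: st_max; rewrite /= s'n t'n.
  apply: le_trans (_ : (zvec s' *m (y *m Y)^T) 0 0 <= _).
    by move: s'x; rewrite trmx_mul YT mulmxA.
  have sw (u v : 'rV[R]_r) : (u *m v^T) 0 0 = (v *m u^T) 0 0.
    by rewrite -[v in LHS]trmxK -[v *m _]trmxK trmx_mul !trmxK [RHS]mxE.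
  by rewrite trmx_mul YT mulmxA sw /F /= [leRHS]sw.
- have even_pow z : 0 <= z ^+ (q * 2) :> R by rewrite exprn_even_ge0 // oddM andbF.
  rewrite (bigD1 s) //= (bigD1 t) //= -addrA lerDl addr_ge0 ?sumr_ge0 // => u _.
  by rewrite sumr_ge0.
Qed.

(** The form is tested on v and [v *m Y], both rescaled to squared length r. *)
Lemma bilinear_le_sqn (Y : 'M[R]_r) m : Y^T = Y -> 0 <= m ->
  (forall x y, sqn x <= r%:R -> sqn y <= r%:R -> (x *m Y *m y^T) 0 0 <= m) ->
  forall v, r%:R ^+ 2 * sqn (v *m Y) <= m ^+ 2 * sqn v.
Proof.
move=> YT m0 Ym v; set u := v *m Y.
have [v0|] := eqVneq (sqn v) 0.
  by rewrite /u (sqn0_eq0 v0) mul0mx -(scale0r (0 : 'rV_r)) sqnZ expr0n !mul0r !mulr0.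
have [->|u_neq v_neq] := eqVneq (sqn u) 0; first by rewrite mulr0 mulr_ge0 ?sqr_ge0 ?sqn_ge0.
have v_gt : 0 < sqn v by rewrite lt_neqAle eq_sym v_neq sqn_ge0.
have u_gt : 0 < sqn u by rewrite lt_neqAle eq_sym u_neq sqn_ge0.
pose a := Num.sqrt (r%:R / sqn v); pose b := Num.sqrt (r%:R / sqn u).
have a2 : a ^+ 2 = r%:R / sqn v by rewrite sqr_sqrtr // divr_ge0 // ltW.
have b2 : b ^+ 2 = r%:R / sqn u by rewrite sqr_sqrtr // divr_ge0 // ltW.
have := Ym (a *: v) (b *: u).
rewrite !sqnZ a2 b2 !divfK // => /(_ (lexx _) (lexx _)).
have -> : (a *: v *m Y *m (b *: u)^T) 0 0 = a * b * sqn u.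
  rewrite -scalemxAl linearZ /= -scalemxAl -scalemxAr scalerA mxE sqnE.
  by congr (_ * _).
move=> abm; have ab0 : 0 <= a * b * sqn u by rewrite !mulr_ge0 ?sqrtr_ge0 ?sqn_ge0.
have : (a * b * sqn u) ^+ 2 <= m ^+ 2 by rewrite lerXn2r.
rewrite !exprMn a2 b2 => H; rewrite -ler_pdivrMr //; apply: le_trans H.
by rewrite le_eqVlt; apply/orP; left; apply/eqP; field; rewrite u_neq.
Qed.

(** The coefficients of the bilinear form of the sign matrix with respect to the independent signs:
    an off-diagonal sign fills two entries, a diagonal one only one. *)
Definition bilin_coef (x y : 'rV[R]_r) (k : 'I_r * 'I_r) : R :=
  if (k.1 <= k.2)%N then
    x 0 k.1 * y 0 k.2 + (if k.1 == k.2 then 0 else x 0 k.2 * y 0 k.1)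
  else 0.

Lemma bilin_rsum (x y : 'rV[R]_r) (e : {ffun 'I_r * 'I_r -> bool}) :
  (x *m kmx (const_mx 1) (fun k => sgn R (e k)) *m y^T) 0 0 =
  rsum (bilin_coef x y) e.
Proof.
have -> : (x *m kmx (const_mx 1) (fun k => sgn R (e k)) *m y^T) 0 0 =
    \sum_(k : 'I_r * 'I_r) x 0 k.1 * y 0 k.2 * sgn R (e (key k.1 k.2)).
  rewrite mxE -(pair_bigA _ (fun i j => x 0 i * y 0 j * sgn R (e (key i j)))) /=.
  rewrite exchange_big; apply: eq_bigr => j _ /=; rewrite mxE big_distrl /=.
  by apply: eq_bigr => i _; rewrite !mxE mulr1 mulrAC.
rewrite (bigID (fun k : 'I_r * 'I_r => (k.1 <= k.2)%N)) /=.
rewrite [X in _ + X](reindex_inj (h := fun k : 'I_r * 'I_r => (k.2, k.1))) /=; last first.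
  by move=> [i j] [i' j'] [-> ->].
rewrite (eq_bigr (fun k : 'I_r * 'I_r => x 0 k.1 * y 0 k.2 * sgn R (e k))) => [|k kk]; last first.
  by rewrite key_id.
rewrite [X in _ + X](eq_bigr (fun k : 'I_r * 'I_r => x 0 k.2 * y 0 k.1 * sgn R (e k))) => [|k kk]; last first.
  by rewrite keyC key_id // ltnW // ltnNge.
rewrite big_mkcond [X in _ + X]big_mkcond -big_split /=.
apply: eq_bigr => k _; rewrite /bilin_coef -ltnNge.
have -> : (k.1 < k.2)%N = (k.1 <= k.2)%N && (k.1 != k.2) by rewrite ltn_neqAle andbC.
by case: leqP => //= _; [case: eqP => /= _; ring | ring].
Qed.

Lemma bilin_coef_sqr (x y : 'rV[R]_r) :
  \sum_k bilin_coef x y k ^+ 2 <= 4 * sqn x * sqn y.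
Proof.
pose G (k : 'I_r * 'I_r) := x 0 k.1 ^+ 2 * y 0 k.2 ^+ 2.
have GE : \sum_k G k = sqn x * sqn y.
  rewrite -(pair_bigA _ (fun i j => x 0 i ^+ 2 * y 0 j ^+ 2)) big_distrl /=.
  by apply: eq_bigr => i _; rewrite big_distrr.
have GE' : \sum_k G (k.2, k.1) = sqn x * sqn y.
  rewrite -GE [RHS](reindex_inj (h := fun k : 'I_r * 'I_r => (k.2, k.1))) //.
  by move=> [i j] [i' j'] [-> ->].
have -> : 4 * sqn x * sqn y = \sum_k (2 * G k + 2 * G (k.2, k.1)).
  by rewrite big_split /= -!big_distrr /= GE GE'; ring.
apply: ler_sum => -[i j] _; rewrite /bilin_coef /G /=.
have := sqr_ge0 (x 0 i * y 0 j - x 0 j * y 0 i).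
have := sqr_ge0 (x 0 i * y 0 j); have := sqr_ge0 (x 0 j * y 0 i).
rewrite !exprMn; case: ifP => _; last by rewrite expr0n /= ?mulr0n; lra.
by case: eqP => _; nra.
Qed.

(** The union bound, with the maximum over the net replaced by a sum. [khintchine] applies to each
    pair of net vectors with sum of squares at most 4 (4 r)^2, and 4 q * 64 r^2 = 256 q r^2, where
    r^2 cancels against the normalisation. There are at most 64^(2 r) pairs. *)
Lemma sgn_matrix_moment q (v0 : 'I_r) :
  \sum_(e : {ffun 'I_r * 'I_r -> bool})
    ((kmx (const_mx 1) (fun k => sgn R (e k))) ^+ (q * 2)) v0 v0 <=
  #|{: {ffun 'I_r * 'I_r -> bool}}|%:R * (64 ^+ (r * 2) * (256 * q%:R) ^+ q).
Proof.
pose Y (e : {ffun 'I_r * 'I_r -> bool}) : 'M[R]_r := kmx (const_mx 1) (fun k => sgn R (e k)).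
have r0 : (0 < r)%N by case: r v0 => [[]|].
have rq0 : 0 < r%:R ^+ (q * 2) :> R by rewrite exprn_gt0 // ltr0n.
pose S (e : {ffun 'I_r * 'I_r -> bool}) := \sum_(s in net) \sum_(t in net)
  rsum (bilin_coef (zvec s) (zvec t)) e ^+ (q * 2).
have bound (e : {ffun 'I_r * 'I_r -> bool}) : r%:R ^+ (q * 2) * ((Y e) ^+ (q * 2)) v0 v0 <= S e.
  have YT : (Y e)^T = Y e by apply: kmx_sym; rewrite trmx_const.
  have [m [m0 /(bilinear_le_sqn YT m0) mY mS]] := net_max q YT.
  apply: (@le_trans _ _ (m ^+ (q * 2))); last first.
    apply: le_trans mS _; apply: ler_sum => s _; apply: ler_sum => t _.
    by rewrite bilin_rsum.
  rewrite -ler_pdivlMl //.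
  have -> : (r%:R ^+ (q * 2))^-1 * m ^+ (q * 2) = ((m / r%:R) ^+ 2) ^+ q.
    by rewrite -exprM mulnC expr_div_n mulrC.
  apply: diag_exp_le => //; first exact: sqr_ge0.
  move=> v; rewrite expr_div_n mulrAC ler_pdivlMr ?exprn_gt0 ?ltr0n //.
  by rewrite mulrC.
rewrite -(ler_pM2l rq0) big_distrr /=.
apply: le_trans (ler_sum _ (fun e _ => bound e)) _.
rewrite /S exchange_big /=.
under eq_bigr do rewrite exchange_big /=.
pose c := #|{: {ffun 'I_r * 'I_r -> bool}}|%:R * (256 * q%:R * r%:R ^+ 2) ^+ q : R.
apply: (@le_trans _ _ (\sum_(s in net) \sum_(t in net) c)).
  apply: ler_sum => s; rewrite inE => sn; apply: ler_sum => t; rewrite inE => tn.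
  apply: le_trans (khintchine _ _) _; rewrite ler_wpM2l ?ler0n //.
  have A0 : 0 <= \sum_k bilin_coef (zvec s) (zvec t) k ^+ 2.
    by apply: sumr_ge0 => k _; apply: sqr_ge0.
  apply: lerXn2r; rewrite ?nnegrE; try by rewrite !mulr_ge0 ?sqr_ge0 ?ler0n.
  have -> : 256 * q%:R * r%:R ^+ 2 = (4 * q)%:R * (4 * (4 * r)%:R * (4 * r)%:R) :> R.
    by rewrite !natrM; ring.
  rewrite ler_wpM2l //; apply: le_trans (bilin_coef_sqr _ _) _.
  by rewrite -!mulrA ler_wpM2l // ler_pM ?sqn_ge0.
have sum_net (z : R) : \sum_(s in net) \sum_(t in net) z = z * (#|net|%:R * #|net|%:R).
  by rewrite !sumr_const mulrA !mulr_natr.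
rewrite sum_net /c exprMn.
have -> : r%:R ^+ (q * 2) * (#|{: {ffun 'I_r * 'I_r -> bool}}|%:R *
    (64 ^+ (r * 2) * (256 * q%:R) ^+ q)) =
  #|{: {ffun 'I_r * 'I_r -> bool}}|%:R * ((256 * q%:R) ^+ q * (r%:R ^+ 2) ^+ q) *
    (64 ^+ r * 64 ^+ r) :> R.
  rewrite (muln2 r) -addnn exprD (mulnC q) exprM.
  by move: (_ ^+ r) (_ ^+ q) (_ ^+ q) #|_|%:R => x y z t; ring.
apply: ler_wpM2l; last by apply: ler_pM; rewrite ?ler0n ?card_net.
by apply/mulr_ge0/mulr_ge0/exprn_ge0/sqr_ge0; rewrite ?ler0n // exprn_ge0 ?mulr_ge0 ?ler0n.
Qed.

End SignMatrix.

(** * Singular values of symmetric matrices *)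

Section Schatten.
Variables (R : realType).

Lemma cauchy_schwarz_rV d (u v : 'rV[R]_d) :
  (u *m v^T) 0 0 <= Num.sqrt (sqn u) * Num.sqrt (sqn v).
Proof.
have [u0|u_neq] := eqVneq (sqn u) 0.
  by rewrite (sqn0_eq0 u0) mul0mx mxE mulr_ge0 ?sqrtr_ge0.
have [v0|v_neq] := eqVneq (sqn v) 0.
  by rewrite (sqn0_eq0 v0) trmx0 mulmx0 mxE mulr_ge0 ?sqrtr_ge0.
set a := Num.sqrt (sqn u); set b := Num.sqrt (sqn v).
have a0 : 0 < a by rewrite sqrtr_gt0 lt_neqAle eq_sym u_neq sqn_ge0.
have b0 : 0 < b by rewrite sqrtr_gt0 lt_neqAle eq_sym v_neq sqn_ge0.
have a2 : a ^+ 2 = sqn u by rewrite sqr_sqrtr ?sqn_ge0.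
have b2 : b ^+ 2 = sqn v by rewrite sqr_sqrtr ?sqn_ge0.
have := sqn_ge0 (b *: u - a *: v).
have -> : sqn (b *: u - a *: v) = 2 * (a * b) * (a * b - (u *m v^T) 0 0).
  rewrite mulrBr.
  have -> : 2 * (a * b) * (a * b) = b ^+ 2 * sqn u + a ^+ 2 * sqn v.
    by rewrite -a2 -b2; ring.
  rewrite /sqn mxE !big_distrr /= -big_split /= -sumrB.
  by apply: eq_bigr => j _; rewrite !mxE; ring.
by rewrite pmulr_rge0 ?mulr_gt0 // subr_ge0.
Qed.

Lemma cvg_finsum (T : Type) (F : set_system T) {FF : Filter F} (I : finType)
    (f : I -> T -> R) (l : I -> R) :
  (forall i, f i @ F --> l i) ->
  (fun x => \sum_i f i x) @ F --> \sum_i l i.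
Proof.
move=> fl; elim: (index_enum I) => [|i s IHs].
  rewrite big_nil (_ : (fun x => _) = (fun=> 0)); first exact: cvg_cst.
  by apply/funext => x; rewrite big_nil.
rewrite big_cons (_ : (fun x => _) = (f i \+ (fun x => \sum_(j <- s) f j x))).
  exact: cvgD.
by apply/funext => x; rewrite big_cons.
Qed.

Lemma continuous_sqn_mul d (M : 'M[R]_d) :
  continuous (fun v : 'rV[R]_d => sqn (v *m M)).
Proof.
rewrite /sqn => v; have FFv := @nbhs_filter _ v.
apply: (@cvg_finsum _ _ FFv) => j.
rewrite (_ : (fun v : 'rV[R]_d => _) =
    (fun v : 'rV[R]_d => (v *m M) 0 j * (v *m M) 0 j)); last first.
  by apply/funext => w; rewrite expr2.
have H : (fun v : 'rV[R]_d => (v *m M) 0 j) @ v --> (v *m M) 0 j.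
  rewrite (_ : (fun v : 'rV[R]_d => _) = (fun v : 'rV[R]_d => \sum_i v 0 i * M i j)); last first.
    by apply/funext => w; rewrite mxE.
  rewrite mxE; apply: (@cvg_finsum _ _ FFv) => i; apply: cvgMr_tmp.
  exact: coord_continuous.
by rewrite expr2; apply: cvgM.
Qed.

Lemma sphere_compact d : compact [set v : 'rV[R]_d | sqn v = 1].
Proof.
apply: bounded_closed_compact.
  exists 1; split; first exact: num_real.
  move=> M M1 v /= v1; apply: le_trans (ltW M1).
  rewrite [leLHS]mx_normrE; apply/bigmax_leP; split => // -[i j] _ /=.
  rewrite (ord1 i) -(@ler_pXn2r _ 2) ?nnegrE // expr1n.
  rewrite real_normK ?num_real // -v1 /sqn (bigD1 j) //= lerDl.
  by apply: sumr_ge0 => k _; apply: sqr_ge0.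
rewrite (_ : mkset _ = (fun v : 'rV[R]_d => sqn (v *m 1%:M)) @^-1` [set 1]).
  apply: preimage_closed; last exact: closed_eq.
  by move=> v _; apply: continuous_sqn_mul.
by apply/seteqP; split => v /=; rewrite mulmx1.
Qed.

Lemma quadratic_ge0_linear0 (b g : R) :
  (forall t, 0 <= 2 * t * b + t ^+ 2 * g) -> b = 0.
Proof.
move=> H; have g0 : 0 <= g by have := H 1; have := H (-1); lra.
(* Near the minimiser - b / g the quadratic is negative unless b = 0; the denominator g + 1 also
   covers g = 0. *)
apply/eqP/negP => /negP b0; have := H (- b / (g + 1)).
have b2 : 0 < b ^+ 2 by rewrite exprn_even_gt0.
have g1 : 0 < g + 1 by lra.
have -> : 2 * (- b / (g + 1)) * b + (- b / (g + 1)) ^+ 2 * g =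
    - (b ^+ 2 * (g + 2)) / (g + 1) ^+ 2 by field; apply: lt0r_neq0.
rewrite mulNr oppr_ge0 leNgt divr_gt0 ?exprn_gt0 // mulr_gt0 //; lra.
Qed.

(* The maximum of v |-> |v M|^2 on the unit sphere is an eigenvalue of M^T M,
   by the first-order condition. *)
Lemma top_singular_value d (M : 'M[R]_d) : (0 < d)%N -> M^T = M ->
  exists a, [/\ 0 <= a, eigenvalue (M^T *m M) a &
    forall v, sqn (v *m M) <= a * sqn v].
Proof.
move=> d0 MT; pose A := [set v : 'rV[R]_d | sqn v = 1].
have A0 : A !=set0 by exists (delta_mx 0 (Ordinal d0)); exact: sqn_delta.
have cf : {within A, continuous (fun v : 'rV[R]_d => sqn (v *m M))}.
  exact/continuous_subspaceT/continuous_sqn_mul.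
have [c /set_mem c1 c_max] := EVT_max_rV A0 (@sphere_compact d) cf.
set a := sqn (c *m M) in c_max.
have aM v : sqn (v *m M) <= a * sqn v.
  have [v0|v_neq] := eqVneq (sqn v) 0.
    by rewrite (sqn0_eq0 v0) mul0mx -(scale0r (0 : 'rV_d)) sqnZ expr0n !mul0r mulr0.
  have v_gt : 0 < sqn v by rewrite lt_neqAle eq_sym v_neq sqn_ge0.
  have s2 : (Num.sqrt (sqn v))^-1 ^+ 2 = (sqn v)^-1.
    by rewrite exprVn sqr_sqrtr // ltW.
  have := c_max ((Num.sqrt (sqn v))^-1 *: v).
  rewrite inE /A /= sqnZ s2 mulVf // -scalemxAl sqnZ s2 => /(_ erefl).
  by rewrite ler_pdivrMl // mulrC.
exists a; split=> //; first exact: sqn_ge0.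
(* Half the gradient at c of the nonnegative function v |-> a |v|^2 - |v M|^2, which vanishes at
   c. *)
pose w := a *: c - c *m M *m M.
have w_orth (u : 'rV[R]_d) : (w *m u^T) 0 0 = 0.
  pose beta := (w *m u^T) 0 0.
  pose g := a * sqn u - sqn (u *m M).
  apply: (@quadratic_ge0_linear0 _ g) => t.
  have := aM (c + t *: u); rewrite -subr_ge0; congr (0 <= _).
  have sqnD (x y : 'rV[R]_d) : sqn (x + t *: y) = sqn x + 2 * t * (x *m y^T) 0 0 + t ^+ 2 * sqn y.
    rewrite /sqn mxE !big_distrr /= -!big_split /=.
    by apply: eq_bigr => j _; rewrite !mxE; ring.
  have -> : (w *m u^T) 0 0 = a * (c *m u^T) 0 0 - (c *m M *m M *m u^T) 0 0.
    by rewrite mulmxBl -scalemxAl mxE [X in X + _]mxE [X in _ + X]mxE.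
  by rewrite mulmxDl -scalemxAl !sqnD c1 -/a /g trmx_mul MT mulmxA; ring.
have w0 : w = 0 by apply: sqn0_eq0; rewrite sqnE w_orth.
apply/eigenvalueP; exists c.
  by apply/eqP; rewrite eq_sym -subr_eq0 MT mulmxA; apply/eqP.
apply/eqP => c0; move: c1; rewrite /A /= c0 -(scale0r (0 : 'rV_d)) sqnZ expr0n mul0r => /eqP.
by rewrite eq_sym oner_eq0.
Qed.

(** This identifies the supremum in [schatten_infty] with the operator norm: no eigenvalue of M^T M
    exceeds the maximal quotient a, and a is itself one. *)
Lemma schattenE d (M : 'M[R]_d) : (0 < d)%N -> M^T = M ->
  exists a, [/\ 0 <= a, eigenvalue (M^T *m M) a,
    (forall v, sqn (v *m M) <= a * sqn v) & schatten_infty M = Num.sqrt a].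
Proof.
move=> d0 MT; have [a [a0 ea aM]] := top_singular_value d0 MT.
have eigen_le b : eigenvalue (M^T *m M) b -> b <= a.
  move=> /eigenvalueP[v]; rewrite MT => vb v0.
  have v_gt : 0 < sqn v.
    rewrite lt_neqAle sqn_ge0 eq_sym andbT.
    by apply: contra_neq v0 => /sqn0_eq0.
  rewrite -(ler_pM2r v_gt); apply: le_trans (aM v).
  rewrite [sqn (v *m M)]sqnE trmx_mul MT mulmxA -(mulmxA v) vb.
  by rewrite -scalemxAl mxE -sqnE.
exists a; split=> //; apply/le_anti/andP; split.
  apply: ge_sup; first by exists (Num.sqrt a); exists a.
  by move=> _ [b /eigen_le ba <-]; rewrite ler_sqrt.
apply: ub_le_sup; last by exists a.
by exists (Num.sqrt a) => _ [b /eigen_le ba <-]; rewrite ler_sqrt.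
Qed.

Section Bounds.
Variables (d : nat) (d0 : (0 < d)%N).
Implicit Types (M : 'M[R]_d) (v : 'rV[R]_d).

Lemma schatten_ge0 M : M^T = M -> 0 <= schatten_infty M.
Proof. by move=> /(schattenE d0)[a [_ _ _ ->]]; apply: sqrtr_ge0. Qed.

Lemma sqn_schatten M v : M^T = M ->
  sqn (v *m M) <= schatten_infty M ^+ 2 * sqn v.
Proof. by move=> /(schattenE d0)[a [a0 _ aM ->]]; rewrite sqr_sqrtr. Qed.

Lemma schatten_le M c : M^T = M -> 0 <= c ->
  (forall v, sqn (v *m M) <= c ^+ 2 * sqn v) -> schatten_infty M <= c.
Proof.
move=> MT c0 Mc; have [a [a0 /eigenvalueP[v]]] := schattenE d0 MT.
rewrite MT => va v0 _ ->; rewrite -[c]ger0_norm // -sqrtr_sqr ler_sqrt ?sqr_ge0 //.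
have v_gt : 0 < sqn v.
  rewrite lt_neqAle sqn_ge0 eq_sym andbT.
  by apply: contra_neq v0 => /sqn0_eq0.
rewrite -(ler_pM2r v_gt); apply: le_trans (Mc v).
rewrite [sqn (v *m M)]sqnE trmx_mul MT mulmxA -(mulmxA v) va.
by rewrite -scalemxAl mxE -sqnE.
Qed.

(** For a top eigenvector v of M^2, |v M^q|^2 is a^q |v|^2. By Cauchy-Schwarz, column by column, it
    is at most |v|^2 times the squared Frobenius norm of M^q, which is the trace of M^(2q). No
    diagonalisation of M is involved. *)
Lemma schatten_exp_le_trace M q : M^T = M ->
  schatten_infty M ^+ (q * 2) <= \tr (M ^+ (q * 2)).
Proof.
move=> MT; have [a [a0 /eigenvalueP[v]]] := schattenE d0 MT.
rewrite MT => va v0 _ ->; rewrite mulnC exprM sqr_sqrtr //.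
have v_gt : 0 < sqn v.
  rewrite lt_neqAle sqn_ge0 eq_sym andbT.
  by apply: contra_neq v0 => /sqn0_eq0.
have vaq : v *m M ^+ (2 * q) = a ^+ q *: v.
  rewrite exprM; elim: q => [|q IHq]; first by rewrite !expr0 mulmx1 scale1r.
  by rewrite exprSr mulmxA IHq -scalemxAl expr2 va scalerA -exprSr.
rewrite -(ler_pM2r v_gt).
have -> : a ^+ q * sqn v = sqn (v *m M ^+ q).
  rewrite [RHS]sqnE trmx_mul trmx_exp // mulmxA -(mulmxA v).
  have -> : M ^+ q *m M ^+ q = M ^+ (2 * q) by rewrite mul2n -addnn exprD.
  by rewrite vaq -scalemxAl mxE -sqnE.
have -> : \tr (M ^+ (2 * q)) = \sum_j sqn (col j (M ^+ q))^T.
  rewrite mulnC; apply: eq_bigr => i _; rewrite diag_exp_double //.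
  by rewrite -{2}(trmx_exp q MT) tr_col trmxK.
rewrite big_distrl /=; apply: ler_sum => j _.
have := cauchy_schwarz_rV v (col j (M ^+ q))^T.
have := cauchy_schwarz_rV (- v) (col j (M ^+ q))^T.
have -> : sqn (- v) = sqn v by rewrite -scaleN1r sqnZ sqrrN expr1n mul1r.
rewrite trmxK mulNmx mxE.
have -> : (v *m col j (M ^+ q)) 0 0 = (v *m M ^+ q) 0 j.
  by rewrite !mxE; apply: eq_bigr => i _; rewrite mxE.
rewrite lerNl => H1 H2; rewrite -(sqr_sqrtr (sqn_ge0 v)).
rewrite -(sqr_sqrtr (sqn_ge0 _)) -exprMn [X in _ <= X ^+ 2]mulrC.
rewrite -[leLHS]real_normK ?num_real // lerXn2r ?nnegrE ?mulr_ge0 ?sqrtr_ge0 //.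
by rewrite ler_norml H1 H2.
Qed.

(** With u = v M, expand |u|^2 as the sum of w_i times the scalar products of v M_i with u, apply
    Cauchy-Schwarz and divide by |u|. *)
Lemma schatten_sum (I : finType) (w : I -> R) (M_ : I -> 'M[R]_d) :
  (forall i, 0 <= w i) -> (forall i, (M_ i)^T = M_ i) ->
  schatten_infty (\sum_i w i *: M_ i) <= \sum_i w i * schatten_infty (M_ i).
Proof.
move=> w0 MT; set M := \sum_i _; set c := \sum_i _.
have c0 : 0 <= c by apply: sumr_ge0 => i _; rewrite mulr_ge0 ?schatten_ge0.
have symM : M^T = M.
  by rewrite /M linear_sum; apply: eq_bigr => i _; rewrite linearZ /= MT.
apply: schatten_le => // v; set u := v *m M.
have : sqn u <= c * Num.sqrt (sqn v) * Num.sqrt (sqn u).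
  rewrite [leLHS]sqnE {1}/u /M mulmx_sumr mulmx_suml summxE /c !big_distrl /=.
  apply: ler_sum => i _; rewrite -scalemxAr -scalemxAl mxE -!mulrA ler_wpM2l //.
  apply: le_trans (cauchy_schwarz_rV _ _) _; rewrite mulrA ler_wpM2r ?sqrtr_ge0 //.
  rewrite -[X in _ <= X * _]ger0_norm ?schatten_ge0 // -sqrtr_sqr -sqrtrM ?sqr_ge0 //.
  rewrite ler_sqrt; first exact: sqn_schatten.
  by rewrite mulr_ge0 ?sqr_ge0 ?sqn_ge0.
have [->|u_neq] := eqVneq (sqn u) 0.
  by move=> _; rewrite mulr_ge0 ?sqr_ge0 ?sqn_ge0.
have u_gt : 0 < Num.sqrt (sqn u) by rewrite sqrtr_gt0 lt_neqAle eq_sym u_neq sqn_ge0.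
rewrite -{1}(sqr_sqrtr (sqn_ge0 u)) expr2 ler_pM2r // => H.
rewrite -(sqr_sqrtr (sqn_ge0 u)) -(sqr_sqrtr (sqn_ge0 v)) -exprMn.
by rewrite lerXn2r ?nnegrE ?mulr_ge0 ?sqrtr_ge0.
Qed.

(** Replacing the coordinates of v by their absolute values keeps its length and, with B in place of
    M, can only enlarge the image coordinatewise. *)
Lemma schatten_entrywise_le M (B : 'M[R]_d) : M^T = M -> B^T = B ->
  (forall i j, `|M i j| <= B i j) -> schatten_infty M <= schatten_infty B.
Proof.
move=> MT BT MB; apply: schatten_le; rewrite ?schatten_ge0 // => v.
pose u : 'rV[R]_d := \row_j `|v 0 j|.
have -> : sqn v = sqn u.
  by apply: eq_bigr => j _; rewrite mxE real_normK ?num_real.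
apply: le_trans (sqn_schatten u BT); apply: ler_sum => j _.
have H : `|(v *m M) 0 j| <= (u *m B) 0 j.
  rewrite !mxE; apply: le_trans (ler_norm_sum _ _ _) _.
  by apply: ler_sum => i _; rewrite mxE normrM ler_wpM2l.
rewrite -[leLHS]real_normK ?num_real // lerXn2r ?nnegrE //.
exact: le_trans H.
Qed.

End Bounds.

End Schatten.

(** * Moving averages of signs *)

(** The factor per unit of p in the moment of the sign matrix of size r = 4 p: there 64^(2 r) is the
    p-th power of 64^8. *)
Definition rademacher_const (R : pzSemiRingType) : R := 64 ^+ 8 * 256.

Lemma rademacher_trace (R : realType) (K : finType) d (b : 'M[R]_d)
    (iota : 'I_d * 'I_d -> K) p :
  b^T = b -> (forall i j, 0 <= b i j <= 1) ->
  {in upper d &, injective iota} -> (0 < p)%N ->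
  (forall i, \sum_j b i j ^+ 2 <= p%:R) ->
  \sum_(e : {ffun K -> bool}) \tr ((kmx b (fun k => sgn R (e (iota k)))) ^+ (p * 2)) <=
  #|{: {ffun K -> bool}}|%:R * (d%:R * (rademacher_const R * p%:R) ^+ p).
Proof.
(* The size 4 p leaves room for the 2 p + 1 vertices of a walk and p free labels besides. *)
move=> bT b01 iotaI p0 rowb; pose r := (4 * p)%N.
have r0 : (0 < r)%N by rewrite muln_gt0.
pose v0 : 'I_r := Ordinal r0.
apply: le_trans (sum_sgn_trace_le v0 bT b01 iotaI rowb _) _; first by rewrite /r; lia.
rewrite natrM -mulrA ler_wpM2l ?ler0n // ler_wpM2l ?ler0n //.
have E0 : 0 < #|{: {ffun 'I_r * 'I_r -> bool}}|%:R :> R.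
  by rewrite ltr0n card_ffun expn_gt0 card_bool.
rewrite -(ler_pM2l E0) -count_walks_sgn.
apply: le_trans (sgn_matrix_moment R p v0) _.
apply: ler_wpM2l; first exact: ler0n.
by rewrite /r mulnAC (exprM 64 (4 * 2)) -exprMn /rademacher_const mulrA.
Qed.

Lemma tangent_power (R : realDomainType) (x y : R) m : 0 <= x -> 0 <= y ->
  y ^+ m.+1 + m.+1%:R * y ^+ m * (x - y) <= x ^+ m.+1.
Proof.
move=> x0 y0; elim: m => [|m IHm]; first by rewrite !expr1 expr0 !mul1r subrKC.
rewrite [x ^+ _]exprS; apply: le_trans (ler_wpM2l x0 IHm).
rewrite -subr_ge0.
have -> : x * (y ^+ m.+1 + m.+1%:R * y ^+ m * (x - y)) -
    (y ^+ m.+2 + m.+2%:R * y ^+ m.+1 * (x - y)) =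
    m.+1%:R * y ^+ m * (x - y) ^+ 2.
  by rewrite !exprS expr0 -![in LHS]natr1; ring.
by apply: mulr_ge0; [apply: mulr_ge0; [exact: ler0n|exact: exprn_ge0]|exact: sqr_ge0].
Qed.

(** Jensen's inequality: average the tangent at the mean y, whose linear term then disappears. *)
Lemma power_mean (R : realDomainType) (I : finType) (v x : I -> R) m :
  (forall i, 0 <= v i) -> \sum_i v i = 1 -> (forall i, 0 <= x i) ->
  (\sum_i v i * x i) ^+ m <= \sum_i v i * x i ^+ m.
Proof.
move=> v0 v1 x0; case: m => [|m].
  by rewrite expr0 (eq_bigr v) ?v1 // => i _; rewrite expr0 mulr1.
set y := \sum_i v i * x i.
have y0 : 0 <= y by apply: sumr_ge0 => i _; rewrite mulr_ge0.
have -> : y ^+ m.+1 = \sum_i v i * (y ^+ m.+1 + m.+1%:R * y ^+ m * (x i - y)).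
  under eq_bigr => i _ do rewrite mulrDr mulrCA mulrBr.
  by rewrite big_split -big_distrl -big_distrr sumrB -big_distrl /= v1 !mul1r subrr mulr0 addr0.
by apply: ler_sum => i _; rewrite ler_wpM2l // tangent_power.
Qed.

(** A trace moment is a combination of mixed moments whose coefficients are products of entries of
    b, hence nonnegative. *)
Lemma trace_dominate (R : realFieldType) d (b : 'M[R]_d) (I J : finType)
    (p : I -> R) (x : I -> 'I_d * 'I_d -> R)
    (q : J -> R) (y : J -> 'I_d * 'I_d -> R) c m :
  (forall i j, 0 <= b i j) ->
  (forall ks, size ks = m -> \sum_i p i * \prod_(k <- ks) x i k <=
     c * \sum_j q j * \prod_(k <- ks) y j k) ->
  \sum_i p i * \tr ((kmx b (x i)) ^+ m) <= c * \sum_j q j * \tr ((kmx b (y j)) ^+ m).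
Proof.
move=> b0 H.
have trE (L : finType) (w : L -> R) (z : L -> 'I_d * 'I_d -> R) :
    \sum_l w l * \tr ((kmx b (z l)) ^+ m) = \sum_i \sum_(t : m.-tuple 'I_d)
      (wprod b i t * (last i t == i)%:R) * \sum_l w l * \prod_(k <- keys i t) z l k.
  under eq_bigr do rewrite big_distrr /=.
  rewrite exchange_big; apply: eq_bigr => i _ /=.
  under eq_bigr do rewrite expmx_walks big_distrr /=.
  rewrite exchange_big; apply: eq_bigr => t _ /=; rewrite big_distrr /=.
  by apply: eq_bigr => l _; rewrite wprod_kmx; ring.
rewrite !trE big_distrr; apply: ler_sum => i _ /=.
rewrite big_distrr; apply: ler_sum => t _ /=; rewrite mulrCA ler_wpM2l //.
  rewrite mulr_ge0 ?ler0n //.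
  by elim: (tval t) i => //= j s IHs i; rewrite mulr_ge0.
by apply: H; rewrite size_keys size_tuple.
Qed.

Section MovingAverage.
Variables (R : realType) (n S : nat) (al mu : R).
Hypotheses (al0 : 0 <= al) (mu0 : 0 <= mu).
Let E := {ffun 'I_(n + S).+1 -> bool}.

(** For k <= n every index k + s is below (n + S).+1, so [inord] does not fall back on its
    default. *)
Definition moving_average (k : nat) (e : E) : R :=
  \sum_(s < S) al * mu ^+ s * sgn R (e (inord (k + s))).

(** Expanding the moving averages leaves monomials in the signs, with nonnegative coefficients and
    nonnegative sums. The list js collects the signs already expanded. *)
Let MA_prod_ge0 (js : seq 'I_(n + S).+1) (ks : seq nat) :
  0 <= \sum_(e : E) \prod_(j <- js) sgn R (e j) * \prod_(k <- ks) moving_average k e.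
Proof.
elim: ks js => [|k ks IHks] js.
  under eq_bigr do rewrite big_nil mulr1.
  by rewrite sum_sgn_prod ler0n.
have -> : \sum_(e : E) \prod_(j <- js) sgn R (e j) * \prod_(k <- k :: ks) moving_average k e =
    \sum_(s < S) al * mu ^+ s * \sum_(e : E) \prod_(j <- inord (k + s) :: js) sgn R (e j) *
      \prod_(k <- ks) moving_average k e.
  under [RHS]eq_bigr do rewrite big_distrr /=.
  rewrite [RHS]exchange_big; apply: eq_bigr => e _ /=.
  rewrite big_cons {1}/moving_average big_distrl big_distrr /=.
  by apply: eq_bigr => s _; rewrite big_cons; ring.
by apply: sumr_ge0 => s _; rewrite !mulr_ge0 ?exprn_ge0.
Qed.

Hypothesis al_large : 1 <= al ^+ 2 * \sum_(t < S - n) mu ^+ (t * 2).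

(** Expand the factors at a and b and keep only the terms in which both choose the same sign, of
    index b + t; the others are nonnegative. The kept terms give mu^(b - a) times al^2 times the sum
    of the mu^(2 t). Here t < S - n ensures that the offset t + (b - a) from a stays below S. *)
Let MA_step a b (ks : seq nat) : (a <= b <= n)%N ->
  mu ^+ (b - a) * \sum_(e : E) \prod_(k <- ks) moving_average k e <=
  \sum_(e : E) \prod_(k <- [:: a, b & ks]) moving_average k e.
Proof.
move=> /andP[ab bn]; set G := fun e => \prod_(k <- ks) moving_average k e.
have G0 : 0 <= \sum_(e : E) G e.
  have := MA_prod_ge0 [::] ks; congr (0 <= _).
  by apply: eq_bigr => e _; rewrite big_nil mul1r.
pose c s t := al ^+ 2 * mu ^+ (s + t).
have c0 s t : 0 <= c s t by rewrite mulr_ge0 ?sqr_ge0 ?exprn_ge0.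
pose T s t := \sum_(e : E) sgn R (e (inord (a + s))) * sgn R (e (inord (b + t))) * G e.
have T0 s t : 0 <= T s t.
  have := MA_prod_ge0 [:: inord (a + s); inord (b + t)] ks; congr (0 <= _).
  by apply: eq_bigr => e _; rewrite !big_cons big_nil mulr1.
have -> : \sum_(e : E) \prod_(k <- [:: a, b & ks]) moving_average k e =
    \sum_(t < S) \sum_(s < S) c s t * T s t.
  rewrite /T; under [RHS]eq_bigr do under eq_bigr do rewrite big_distrr /=.
  under [RHS]eq_bigr do rewrite exchange_big /=.
  rewrite [RHS]exchange_big; apply: eq_bigr => e _ /=.
  rewrite !big_cons -/(G e) mulrCA {1}/moving_average big_distrl.
  apply: eq_bigr => t _ /=; rewrite /moving_average big_distrl big_distrr /=.
  by apply: eq_bigr => s _; rewrite /c exprD; ring.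
set g := (b - a)%N; have gn : (g <= n)%N by rewrite leq_subLR; apply: leq_trans bn _; rewrite leq_addl.
apply: (@le_trans _ _ (\sum_(t < S - n) c (t + g)%N t * \sum_(e : E) G e)).
  rewrite -big_distrl /= ler_wpM2r // /c -big_distrr /=.
  rewrite (eq_bigr (fun t : 'I_(S - n) => mu ^+ g * mu ^+ (t * 2))) => [|t _].
    rewrite -big_distrr mulrCA -[leLHS]mulr1 ler_wpM2l ?exprn_ge0 //.
  by rewrite -exprD; congr (_ ^+ _); lia.
rewrite (big_ord_widen S (fun t => c (t + g)%N t * \sum_(e : E) G e)) ?leq_subr //.
rewrite [X in X <= _]big_mkcond; apply: ler_sum => t _.
case: ifP => tS; last by apply: sumr_ge0 => *; rewrite mulr_ge0.
have sS : (t + g < S)%N by lia.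
rewrite (bigD1 (Ordinal sS)) //= -[leLHS]addr0; apply: lerD; last first.
  by apply: sumr_ge0 => *; rewrite mulr_ge0.
rewrite ler_wpM2l // /T le_eqVlt; apply/orP; left; apply/eqP.
apply: eq_bigr => e _.
have -> : (a + (t + g) = b + t)%N by rewrite /g; lia.
by rewrite sgn_sqr mul1r.
Qed.

Fixpoint pair_gaps (ks : seq nat) : nat :=
  if ks is a :: b :: ks' then (b - a + pair_gaps ks')%N else 0%N.

Lemma moving_average_moment ks : sorted leq ks -> ~~ odd (size ks) ->
  all (fun k => k <= n)%N ks ->
  #|{: E}|%:R * mu ^+ pair_gaps ks <=
  \sum_(e : E) \prod_(k <- ks) moving_average k e.
Proof.
have [m] := ubnP (size ks); elim: m ks => // m IHm [|a [|b ks]] //=.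
  by move=> *; rewrite expr0 mulr1 (eq_bigr (fun=> 1)) ?sumr_const // => e _; rewrite big_nil.
move=> sm /andP[ab sks] even_ks /and3P[an bn ksn].
apply: le_trans (MA_step ks (_ : a <= b <= n)%N); last by rewrite ab.
rewrite exprD mulrCA ler_wpM2l ?exprn_ge0 //; apply: IHm => //.
- by lia.
- by move: sks; apply: path_sorted.
- by rewrite negbK in even_ks.
Qed.

End MovingAverage.

Lemma trace_le_schatten (R : realType) d (M : 'M[R]_d) q : (0 < d)%N -> M^T = M ->
  \tr (M ^+ (q * 2)) <= d%:R * schatten_infty M ^+ (q * 2).
Proof.
move=> d0 MT; rewrite mulr_natl -[X in _ *+ X]card_ord -sumr_const.
apply: ler_sum => i _; rewrite [leRHS](_ : _ = (schatten_infty M ^+ 2) ^+ q);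
  last by rewrite -exprM mulnC.
by apply: diag_exp_le => //; [exact: sqr_ge0 | move=> v; exact: sqn_schatten].
Qed.

(** The matrix of moving averages is a combination, of total mass a, of the sign matrices X s.
    Convexity of norm and power reduces to a single s. Passing from the trace to the norm for this
    purpose costs the second factor d. *)
Lemma moving_average_trace (R : realType) n S (al mu : R) d (b : 'M[R]_d)
    (omega : 'I_d * 'I_d -> 'I_n.+1) p :
  0 <= al -> 0 <= mu -> 0 < \sum_(s < S) al * mu ^+ s ->
  (0 < d)%N -> b^T = b -> (forall i j, 0 <= b i j <= 1) ->
  {in upper d &, injective omega} -> (0 < p)%N ->
  (forall i, \sum_j b i j ^+ 2 <= p%:R) ->
  \sum_(e : {ffun 'I_(n + S).+1 -> bool})
    \tr ((kmx b (fun k => moving_average al mu (omega k) e)) ^+ (p * 2)) <=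
  #|{: {ffun 'I_(n + S).+1 -> bool}}|%:R *
    (d%:R ^+ 2 * ((\sum_(s < S) al * mu ^+ s) ^+ 2 * (rademacher_const R * p%:R)) ^+ p).
Proof.
move=> al0 mu0 a0 d0 bT b01 omegaI p0 rowb.
set a := \sum_(s < S) _ in a0 *; pose w (s : 'I_S) := al * mu ^+ s.
have w0 s : 0 <= w s by rewrite mulr_ge0 ?exprn_ge0.
pose iota (s : 'I_S) k : 'I_(n + S).+1 := inord (omega k + s).
pose X s (e : {ffun 'I_(n + S).+1 -> bool}) := kmx b (fun k => sgn R (e (iota s k))).
have XT s e : (X s e)^T = X s e by apply: kmx_sym.
have iotaI s : {in upper d &, injective (iota s)}.
  have small k : (omega k + s < (n + S).+1)%N.
    by have := ltn_ord (omega k); have := ltn_ord s; lia.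
  move=> k l ku lu /(congr1 (@nat_of_ord _)); rewrite !inordK //.
  by move=> /addIn/val_inj; apply: omegaI.
have bound (e : {ffun 'I_(n + S).+1 -> bool}) :
    \tr ((kmx b (fun k => moving_average al mu (omega k) e)) ^+ (p * 2)) <=
    d%:R * (a ^+ (p * 2) * \sum_s w s / a * \tr (X s e ^+ (p * 2))).
  have -> : kmx b (fun k => moving_average al mu (omega k) e) =
      \sum_s w s *: X s e.
    apply/matrixP => i j; rewrite summxE !mxE /moving_average big_distrl /=.
    by apply: eq_bigr => s _; rewrite !mxE /w mulrA.
  have sumT : (\sum_s w s *: X s e)^T = \sum_s w s *: X s e.
    by rewrite linear_sum; apply: eq_bigr => s _; rewrite linearZ /= XT.
  apply: le_trans (trace_le_schatten p d0 sumT) _.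
  rewrite ler_wpM2l ?ler0n //.
  apply: (@le_trans _ _ ((\sum_s w s * schatten_infty (X s e)) ^+ (p * 2))).
    rewrite lerXn2r ?nnegrE ?schatten_ge0 ?schatten_sum //.
    by apply: sumr_ge0 => s _; rewrite mulr_ge0 ?schatten_ge0.
  have -> : \sum_s w s * schatten_infty (X s e) =
      a * \sum_s w s / a * schatten_infty (X s e).
    rewrite big_distrr; apply: eq_bigr => s _ /=; rewrite mulrA mulrCA.
    by rewrite divff ?mulr1 // gt_eqF.
  rewrite exprMn ler_wpM2l ?exprn_ge0 ?(ltW a0) //.
  apply: (@le_trans _ _ (\sum_s w s / a * schatten_infty (X s e) ^+ (p * 2))).
    apply: power_mean.
    - by move=> s; rewrite divr_ge0 // ltW.
    - by rewrite -big_distrl /= divff // gt_eqF.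
    - by move=> s; apply: schatten_ge0.
  apply: ler_sum => s _; rewrite ler_wpM2l ?divr_ge0 ?(ltW a0) //.
  exact: schatten_exp_le_trace.
apply: le_trans (ler_sum _ (fun e _ => bound e)) _.
rewrite -big_distrr /= -big_distrr /= exchange_big /=.
set c := #|_|%:R; have rad s : \sum_e \tr (X s e ^+ (p * 2)) <=
    c * (d%:R * (rademacher_const R * p%:R) ^+ p).
  exact: rademacher_trace.
have -> : c * (d%:R ^+ 2 * (a ^+ 2 * (rademacher_const R * p%:R)) ^+ p) =
    d%:R * (a ^+ (p * 2) * (c * (d%:R * (rademacher_const R * p%:R) ^+ p))).
  by rewrite exprMn -exprM mulnC expr2; move: (_ ^+ p) (_ ^+ (_ * _)) => x y; ring.
rewrite ler_wpM2l ?ler0n // ler_wpM2l ?exprn_ge0 ?(ltW a0) //.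
apply: (@le_trans _ _ (\sum_s w s / a * (c * (d%:R * (rademacher_const R * p%:R) ^+ p)))).
  apply: ler_sum => s _; rewrite -big_distrr /= ler_wpM2l ?divr_ge0 ?(ltW a0) //.
by rewrite -!big_distrl /= divff ?mul1r // gt_eqF.
Qed.

(** Bernoulli's inequality for powers of 1 / mu, cleared of denominators. It makes mu^m at most 1/2
    once m (1 - mu) >= 1. *)
Lemma expr_le_inv (R : realFieldType) (mu : R) m : 0 <= mu <= 1 ->
  mu ^+ m * (1 + m%:R * (1 - mu)) <= 1.
Proof.
move=> /andP[mu0 mu1]; elim: m => [|m IHm]; first by rewrite expr0 mul0r addr0 mulr1.
apply: le_trans IHm; rewrite exprSr -mulrA ler_wpM2l ?exprn_ge0 //.
have : 0 <= m%:R :> R by rewrite ler0n.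
rewrite -natr1; move: m%:R => x x0.
have : 0 <= (x + 1) * (1 - mu) ^+ 2 by rewrite mulr_ge0 ?sqr_ge0 // addr_ge0.
by rewrite expr2; nra.
Qed.

(** Take S = n + m with mu^m <= 1/2, and al^2 = 2 (1 - mu^2). The geometric sums are then al^2 (1 -
    mu^(2m)) / (1 - mu^2) = 2 (1 - mu^(2m)) >= 1 for the variance and at most 2 (1 + mu) / (1 - mu)
    for the squared mass. *)
Lemma moving_average_params (R : realType) n (mu : R) : 0 <= mu < 1 ->
  exists S (al : R), [/\ 0 <= al,
    1 <= al ^+ 2 * \sum_(t < S - n) mu ^+ (t * 2),
    0 < \sum_(s < S) al * mu ^+ s &
    (\sum_(s < S) al * mu ^+ s) ^+ 2 <= 4 / (1 - mu)].
Proof.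
move=> /andP[mu0 mu1]; have d0 : 0 < 1 - mu by rewrite subr_gt0.
pose m := (Num.truncn (1 / (1 - mu))).+1.
have m_large : 1 <= m%:R * (1 - mu).
  by rewrite -ler_pdivrMr // ltW // truncnS_gt.
have mum : mu ^+ m <= 2^-1.
  have := @expr_le_inv _ mu m; rewrite mu0 (ltW mu1) => /(_ isT).
  have := exprn_ge0 m mu0; move: (mu ^+ m) (m%:R * _) m_large => x y; nra.
have geo k (z : R) : (\sum_(s < k) z ^+ s) * (1 - z) = 1 - z ^+ k.
  have /= := subrXX 1 z k; rewrite expr1n => ->; rewrite mulrC; congr (_ * _).
  by apply: eq_bigr => i _; rewrite expr1n mul1r.
have mu2 : 0 < 1 - mu ^+ 2 by nra.
have al2 : Num.sqrt (2 * (1 - mu ^+ 2)) ^+ 2 = 2 * (1 - mu ^+ 2).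
  by rewrite sqr_sqrtr // mulr_ge0 // ltW.
exists (n + m)%N, (Num.sqrt (2 * (1 - mu ^+ 2))).
have sum_le : (\sum_(s < n + m) mu ^+ s) <= (1 - mu)^-1.
  by rewrite -[leRHS]mul1r ler_pdivlMr // geo gerBl exprn_ge0.
split; first exact: sqrtr_ge0.
- rewrite addKn al2 (eq_bigr (fun t : 'I_m => (mu ^+ 2) ^+ t)) => [|t _]; last first.
    by rewrite -exprM mulnC.
  rewrite -mulrA [_ * (\sum_(_ < _) _)]mulrC geo.
  have : (mu ^+ 2) ^+ m <= 2^-1.
    rewrite -exprM mulnC exprM expr2; have := exprn_ge0 m mu0.
    by move: (mu ^+ m) mum => x; nra.
  by lra.
- rewrite -big_distrr /= mulr_gt0 ?sqrtr_gt0 ?mulr_gt0 //.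
  rewrite addnS big_ord_recl expr0 ltr_pwDl //.
  by apply: sumr_ge0 => i _; rewrite exprn_ge0.
- rewrite -big_distrr /= exprMn al2.
  apply: (@le_trans _ _ (2 * (1 - mu ^+ 2) * (1 - mu)^-1 ^+ 2)).
    rewrite ler_wpM2l ?mulr_ge0 ?(ltW mu2) // lerXn2r ?nnegrE ?invr_ge0 ?(ltW d0) //.
    by apply: sumr_ge0 => i _; rewrite exprn_ge0.
  have -> : 2 * (1 - mu ^+ 2) * (1 - mu)^-1 ^+ 2 = 2 * (1 + mu) / (1 - mu).
    by field; rewrite gt_eqF.
  by rewrite ler_wpM2r ?invr_ge0 ?(ltW d0) //; lra.
Qed.

(** * The pair of independent copies of the chain *)

Section Gap.
Variables (R : realType) (N : nat) (A : 'M[R]_N) (pi : 'rV[R]_N).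
Hypotheses (Asto : row_stochastic A) (pi_pos : positive_distribution pi).
Hypothesis pi_inv : invariant_distribution A pi.

Definition mean (u : 'I_N -> R) : R := \sum_i pi 0 i * u i.
Definition msq (u : 'I_N -> R) : R := \sum_i pi 0 i * u i ^+ 2.
Definition kop (u : 'I_N -> R) (i : 'I_N) : R := \sum_j A i j * u j.
Let lam := L2opnorm pi (A - averaging pi).

Let A0 i j : 0 <= A i j. Proof. by case: Asto => + _; apply. Qed.
Let A1 i : \sum_j A i j = 1. Proof. by case: Asto => _; apply. Qed.
Let pi0 i : 0 <= pi 0 i. Proof. by case: pi_pos => /(_ i)/ltW. Qed.
Let pi1 : \sum_i pi 0 i = 1. Proof. by case: pi_pos. Qed.

Lemma msq_ge0 u : 0 <= msq u.
Proof. by apply: sumr_ge0 => i _; rewrite mulr_ge0 ?sqr_ge0. Qed.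

Lemma mean_kop u : mean (kop u) = mean u.
Proof.
rewrite /mean /kop; under eq_bigr do rewrite big_distrr /=.
rewrite exchange_big; apply: eq_bigr => j _ /=.
by rewrite -pi_inv big_distrl; apply: eq_bigr => i _; rewrite mulrA.
Qed.

Lemma sqr_avg_le (w u : 'I_N -> R) : (forall i, 0 <= w i) -> \sum_i w i = 1 ->
  (\sum_i w i * u i) ^+ 2 <= \sum_i w i * u i ^+ 2.
Proof.
move=> w0 w1; set y := \sum_i w i * u i; rewrite -subr_ge0.
have -> : \sum_i w i * u i ^+ 2 - y ^+ 2 = \sum_i w i * (u i - y) ^+ 2.
  have -> : \sum_i w i * (u i - y) ^+ 2 =
      \sum_i (w i * u i ^+ 2 - 2 * y * (w i * u i) + y ^+ 2 * w i).
    by apply: eq_bigr => i _; ring.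
  by rewrite big_split sumrB /= -!big_distrr /= w1 -/y; ring.
by apply: sumr_ge0 => i _; rewrite mulr_ge0 ?sqr_ge0.
Qed.

Lemma sqr_mean_le u : mean u ^+ 2 <= msq u.
Proof. exact: sqr_avg_le. Qed.

Lemma msq_kop_le u : msq (kop u) <= msq u.
Proof.
have -> : msq u = mean (kop (fun i => u i ^+ 2)) by rewrite mean_kop.
by apply: ler_sum => i _; rewrite ler_wpM2l // sqr_avg_le.
Qed.

Lemma L2norm_msq (v : 'cV[R]_N) : L2norm pi v = Num.sqrt (msq (fun i => v i 0)).
Proof. by congr Num.sqrt; apply: eq_bigr => i _; rewrite real_normK ?num_real. Qed.

Lemma mul_centeredE (v : 'cV[R]_N) i :
  ((A - averaging pi) *m v) i 0 = kop (fun i => v i 0) i - mean (fun i => v i 0).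
Proof.
rewrite mulmxBl !mxE; congr (_ - _).
by apply: eq_bigr => j _; rewrite mxE.
Qed.

Lemma msq_centered (u : 'I_N -> R) : msq (fun i => u i - mean u) = msq u - mean u ^+ 2.
Proof.
rewrite /msq (eq_bigr (fun i => pi 0 i * u i ^+ 2 - 2 * mean u * (pi 0 i * u i) +
    mean u ^+ 2 * pi 0 i)) => [|i _]; last by rewrite /=; ring.
by rewrite big_split sumrB /= -!big_distrr /= pi1 -/(mean u); ring.
Qed.

(** Boundedness keeps the supremum from taking its default value. The bound 1 holds because both A
    and the subtraction of the mean are contractions of L2(pi). *)
Lemma L2opnorm_ub : has_ubound
  [set L2norm pi ((A - averaging pi) *m v) | v in [set v | L2norm pi v = 1]].
Proof.
exists 1 => _ [v /= v1 <-]; rewrite -v1 !L2norm_msq ler_sqrt ?msq_ge0 //.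
set u := fun i => v i 0.
have -> : msq (fun i => ((A - averaging pi) *m v) i 0) =
    msq (fun i => kop u i - mean (kop u)).
  by rewrite mean_kop; apply: eq_bigr => i _; rewrite mul_centeredE.
rewrite msq_centered; apply: le_trans (msq_kop_le u).
by rewrite gerBl sqr_ge0.
Qed.

Lemma L2opnorm_ge0 : 0 <= lam.
Proof.
apply: le_trans (_ : L2norm pi ((A - averaging pi) *m const_mx 1) <= _).
  exact: sqrtr_ge0.
apply: ub_le_sup; first exact: L2opnorm_ub.
exists (const_mx 1) => //=; rewrite L2norm_msq /msq.
by under eq_bigr do rewrite mxE expr1n mulr1; rewrite pi1 sqrtr1.
Qed.

Lemma gap_centered u : msq (fun i => kop u i - mean u) <= lam ^+ 2 * msq u.
Proof.
have [u0|u_neq] := eqVneq (msq u) 0.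
  have := msq_kop_le u; rewrite u0 mulr0; apply: le_trans.
  by rewrite -mean_kop msq_centered gerBl sqr_ge0.
have u_gt : 0 < Num.sqrt (msq u) by rewrite sqrtr_gt0 lt_neqAle eq_sym u_neq msq_ge0.
pose v : 'cV[R]_N := \col_i (u i / Num.sqrt (msq u)).
have vE : msq (fun i => v i 0) = 1.
  rewrite /msq; under eq_bigr do rewrite mxE expr_div_n sqr_sqrtr ?msq_ge0 // mulrA.
  by rewrite -big_distrl /= divff.
have : L2norm pi ((A - averaging pi) *m v) <= lam.
  apply: ub_le_sup; first exact: L2opnorm_ub.
  by exists v => //=; rewrite L2norm_msq vE sqrtr1.
have -> : L2norm pi ((A - averaging pi) *m v) =
    Num.sqrt (msq (fun i => kop u i - mean u) / msq u).
  rewrite L2norm_msq; congr Num.sqrt; rewrite /msq big_distrl /=.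
  apply: eq_bigr => i _; rewrite mul_centeredE -mulrA; congr (_ * _).
  have -> : kop (fun i => v i 0) i = kop u i / Num.sqrt (msq u).
    by rewrite /kop big_distrl; apply: eq_bigr => j _; rewrite mxE mulrA.
  have -> : mean (fun i => v i 0) = mean u / Num.sqrt (msq u).
    by rewrite /mean big_distrl; apply: eq_bigr => j _; rewrite mxE mulrA.
  by rewrite -mulrBl expr_div_n sqr_sqrtr ?msq_ge0.
have L0 := L2opnorm_ge0.
have u_gt' : 0 < msq u by rewrite lt_neqAle eq_sym u_neq msq_ge0.
rewrite -{1}[lam]ger0_norm // -sqrtr_sqr ler_sqrt ?sqr_ge0 //.
by rewrite ler_pdivrMr.
Qed.

(** Pythagoras: A preserves the mean of u and contracts the centred part by lam, so the two
    contributions stay orthogonal without reversibility. *)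
Lemma gap_mean u :
  msq (kop u) <= lam ^+ 2 * msq u + (1 - lam ^+ 2) * mean u ^+ 2.
Proof.
have := gap_centered (fun i => u i - mean u).
have m0 : mean (fun i => u i - mean u) = 0.
  rewrite {1}/mean (eq_bigr (fun i => pi 0 i * u i - mean u * pi 0 i)) => [|i _]; last by rewrite /=; ring.
  by rewrite sumrB -big_distrr /= pi1 -/(mean u); ring.
have -> : msq (fun i => kop (fun i => u i - mean u) i - mean (fun i => u i - mean u)) =
    msq (fun i => kop u i - mean (kop u)).
  apply: eq_bigr => i _; rewrite m0 subr0 mean_kop; congr (_ * _ ^+ 2).
  rewrite /kop (eq_bigr (fun j => A i j * u j - mean u * A i j)) => [|j _]; last by rewrite /=; ring.
  by rewrite sumrB -big_distrr /= A1; ring.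
by rewrite !msq_centered mean_kop; lra.
Qed.

(** Mean, squared L2 norm and transition operator for the pair of independent copies, with
    stationary law the product of pi with itself. *)
Definition mean2 (g : 'I_N -> 'I_N -> R) : R := mean (fun x => mean (g x)).
Definition msq2 (g : 'I_N -> 'I_N -> R) : R := mean (fun x => msq (g x)).
Definition kop2 (g : 'I_N -> 'I_N -> R) x y : R := kop (fun x' => kop (g x') y) x.

Lemma mean_exchange (g : 'I_N -> 'I_N -> R) :
  mean (fun x => mean (g x)) = mean (fun y => mean (fun x => g x y)).
Proof.
rewrite /mean; under eq_bigr do rewrite big_distrr /=.
rewrite exchange_big; apply: eq_bigr => y _ /=; rewrite big_distrr /=.
by apply: eq_bigr => x _; rewrite mulrCA.
Qed.

Lemma le_mean u v : (forall i, u i <= v i) -> mean u <= mean v.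
Proof. by move=> uv; apply: ler_sum => i _; rewrite ler_wpM2l. Qed.

Lemma msq2_ge0 g : 0 <= msq2 g.
Proof. by apply: sumr_ge0 => i _; rewrite mulr_ge0 ?msq_ge0. Qed.

Lemma sqr_mean2_le g : mean2 g ^+ 2 <= msq2 g.
Proof.
by apply: le_trans (sqr_mean_le _) _; apply: le_mean => x; apply: sqr_mean_le.
Qed.

Lemma msq2E g : msq2 g = mean (fun y => msq (fun x => g x y)).
Proof. exact: mean_exchange. Qed.

Let msq2_kop_right g : msq2 (fun x y => kop (g x) y) <= msq2 g.
Proof. by apply: le_mean => x; apply: msq_kop_le. Qed.

Lemma msq2_kop2_le g : msq2 (kop2 g) <= msq2 g.
Proof.
apply: le_trans (msq2_kop_right g).
by rewrite !msq2E; apply: le_mean => y; apply: msq_kop_le.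
Qed.

(* The projections of g onto functions of x alone and of y alone are
   orthogonal and have the same norm. *)
Lemma antisym_mean_le g : (forall x y, g y x = - g x y) ->
  2 * msq (fun y => mean (fun x => g x y)) <= msq2 g.
Proof.
move=> ga; pose m y := mean (fun x => g x y).
have m0 : mean m = 0.
  have e1 : mean (fun x => mean (g x)) = mean m by rewrite mean_exchange.
  have e2 : mean (fun x => mean (g x)) = - mean m.
    rewrite /mean -sumrN; apply: eq_bigr => x _; rewrite -mulrN; congr (_ * _).
    by rewrite /m /mean -sumrN; apply: eq_bigr => y _; rewrite ga; ring.
  by lra.
(* This is g minus its two projections: m is the one on functions of y and, by antisymmetry, -m the
   one on functions of x. *)
have := msq2_ge0 (fun x y => g x y - m y + m x).
have -> : msq2 (fun x y => g x y - m y + m x) = msq2 g - 2 * msq m.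
  have -> : msq2 (fun x y => g x y - m y + m x) =
      mean (fun x => mean (fun y => g x y ^+ 2 - 2 * (m y * g x y) +
        (2 * m x * g x y + (m y ^+ 2 + (m x ^+ 2 - 2 * (m x * m y)))))).
    by apply: eq_bigr => x _; congr (_ * _); apply: eq_bigr => y _; congr (_ * _); ring.
  have meanD u v : mean (fun i => u i + v i) = mean u + mean v.
    by rewrite /mean -big_split; apply: eq_bigr => i _; rewrite mulrDr.
  have meanN u : mean (fun i => - u i) = - mean u.
    by rewrite /mean -sumrN; apply: eq_bigr => i _; rewrite mulrN.
  have meanZ c u : mean (fun i => c * u i) = c * mean u.
    by rewrite /mean big_distrr; apply: eq_bigr => i _; rewrite mulrCA.
  have meanC c : mean (fun=> c) = c by rewrite /mean -big_distrl /= pi1 mul1r.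
  have meanx x : mean (g x) = - m x.
    by rewrite /m /mean -sumrN; apply: eq_bigr => y _; rewrite ga; ring.
  have mean_eq u v : u =1 v -> mean u = mean v by move=> uv; apply: eq_bigr => i _; rewrite uv.
  have cross : mean (fun x => mean (fun y => m y * g x y)) = msq m.
    by rewrite mean_exchange; apply: eq_bigr => y _; rewrite meanZ expr2.
  rewrite (mean_eq _ (fun x => msq (g x) - 2 * mean (fun y => m y * g x y) +
    (- 2 * m x ^+ 2 + (msq m + m x ^+ 2)))) => [|x]; last first.
    by rewrite !(meanD, meanN, meanZ, meanC) meanx m0 /msq /mean; ring.
  rewrite !(meanD, meanN, meanZ, meanC) cross /msq2 /msq /mean.
  by ring.
by rewrite subr_ge0.
Qed.

Definition rho := (1 + lam ^+ 2) / 2.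

(** The gap is used in the first variable, for fixed y. It gains lam^2 except on the mean over x,
    and by antisymmetry that mean carries at most half of the squared norm: lam^2 + (1 - lam^2) / 2
    is [rho]. *)
Lemma msq2_kop2_antisym g : lam <= 1 -> (forall x y, g y x = - g x y) ->
  msq2 (kop2 g) <= rho * msq2 g.
Proof.
move=> lam1 ga; have L0 := L2opnorm_ge0.
have L2 : 0 <= 1 - lam ^+ 2 by nra.
pose h x y := kop (g x) y; pose m y := mean (fun x => g x y).
have H1 : msq2 (kop2 g) <= lam ^+ 2 * msq2 h +
    (1 - lam ^+ 2) * msq (kop m).
  rewrite !msq2E.
  have -> : lam ^+ 2 * mean (fun y => msq (fun x => h x y)) + (1 - lam ^+ 2) * msq (kop m) =
     mean (fun y => lam ^+ 2 * msq (fun x => h x y) + (1 - lam ^+ 2) * mean (fun x => h x y) ^+ 2).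
    have mh y : mean (fun x => h x y) = kop m y.
      rewrite /h /mean /kop; under eq_bigr do rewrite big_distrr /=.
      rewrite exchange_big; apply: eq_bigr => z _ /=; rewrite /m /mean big_distrr /=.
      by apply: eq_bigr => x _; rewrite mulrCA.
    rewrite {1}/mean [msq (kop m)]/msq !big_distrr -big_split /=.
    by apply: eq_bigr => y _; rewrite mh; ring.
  by apply: le_mean => y; apply: gap_mean.
have H2 := msq2_kop_right g; rewrite -/h in H2.
have H3 := msq_kop_le m; have H4 := antisym_mean_le ga; rewrite -/m in H4.
have H5 : lam ^+ 2 * msq2 h <= lam ^+ 2 * msq2 g by rewrite ler_wpM2l ?sqr_ge0.
have H6 : (1 - lam ^+ 2) * msq (kop m) <= (1 - lam ^+ 2) * (msq2 g / 2).
  by rewrite ler_wpM2l // ; lra.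
by rewrite /rho; lra.
Qed.

End Gap.

(** * Mixed moments of the symmetrized chain *)

Definition tail_count (ks : seq nat) m k := count (fun t => (k <= t < k + m)%N) ks.

(** This counts the transitions into times k, ..., k + m - 1 at which an odd number of factors is
    still to come, that is, those acting on antisymmetric functions. *)
Definition odd_gaps (ks : seq nat) m k : nat :=
  \sum_(i < m) odd (tail_count ks (m - i) (k + i)).

Lemma tail_countS ks m k :
  tail_count ks m.+1 k = (count_mem k ks + tail_count ks m k.+1)%N.
Proof.
elim: ks => //= t ks; rewrite /tail_count /= => ->.
rewrite addnACA; congr (_ + _)%N; lia.
Qed.

Lemma odd_gapsS ks m k :
  odd_gaps ks m.+1 k = (odd (tail_count ks m.+1 k) + odd_gaps ks m k.+1)%N.
Proof.
rewrite /odd_gaps big_ord_recl /= subn0 addn0; congr (_ + _)%N.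
by apply: eq_bigr => i _; rewrite /= subSS addSnnS.
Qed.

Lemma sum_between n a b : (a <= b)%N ->
  (\sum_(t < n) ((a <= t) && (t < b)) = minn n b - a)%N.
Proof.
move=> ab; elim: n => [|n IHn]; first by rewrite big_ord0 min0n sub0n.
rewrite big_ord_recr /= IHn; case: (leqP a n) => an; case: (leqP b n) => bn /=; lia.
Qed.

(** As the total number is even, the number of times beyond i is odd exactly when i lies between an
    odd-numbered time and the next one. *)
Lemma odd_gaps_sorted n ks : sorted leq ks -> ~~ odd (size ks) ->
  all (fun t => t <= n)%N ks -> odd_gaps ks n 1 = pair_gaps ks.
Proof.
move=> sks eks ksn; rewrite /odd_gaps.
rewrite (eq_bigr (fun i : 'I_n => odd (count (fun t => i < t)%N ks) : nat)) => [|i _]; last first.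
  congr (odd _ : nat); apply: eq_in_count => t /(allP ksn) /= tn.
  have := ltn_ord i; lia.
have [m] := ubnP (size ks); elim: m ks sks eks ksn => // m IHm [|a [|b ks]] //=.
  by move=> *; rewrite big1.
move=> /andP[ab sks]; rewrite negbK => even_ks /and3P[an bn ksn] sm.
rewrite -(IHm ks) //; last by lia.
- have -> : (b - a = minn n b - a)%N by lia.
  rewrite -(sum_between n ab) -big_split /=; apply: eq_bigr => i _.
  have bks : all (leq b) ks by move: sks; rewrite (path_sortedE leq_trans) => /andP[].
  rewrite !oddD !oddb.
  case: (leqP a i) => ai; case: (ltnP i b) => ib /=; rewrite ?negbK ?addbF //=.
  + suff -> : count (fun t => i < t)%N ks = size ks by rewrite (negPf even_ks).
    by apply/eqP; rewrite -all_count; apply: sub_all bks => t /=; lia.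
  + by lia.
- by move: sks; apply: path_sorted.
Qed.

Lemma prod_count_nat (R : comPzSemiRingType) n (z : nat -> R) ks :
  all (fun t => t < n)%N ks ->
  \prod_(k <- ks) z k = \prod_(j < n) z j ^+ count_mem (val j) ks.
Proof.
elim: ks => [|x ks IHks] /=; first by rewrite big_nil big1.
move=> /andP[xn /IHks E]; rewrite big_cons E (bigD1 (Ordinal xn)) //=.
rewrite [RHS](bigD1 (Ordinal xn)) //= eqxx exprS mulrA; congr (_ * _).
apply: eq_bigr => j jx; suff -> : (x == j) = false by [].
by apply: contra_neqF jx => /eqP xj; apply: val_inj.
Qed.

Section Mixing.
Variables (R : realType) (N : nat) (A : 'M[R]_N) (pi : 'rV[R]_N).
Hypotheses (Asto : row_stochastic A) (pi_pos : positive_distribution pi).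
Hypothesis pi_inv : invariant_distribution A pi.
Variable f : 'I_N -> R.
Hypothesis f1 : forall i, -1 <= f i <= 1.
Let lam := L2opnorm pi (A - averaging pi).
Hypothesis lam1 : lam <= 1.
Variable ks : seq nat.

Fixpoint diff_prod k (l l' : seq 'I_N) : R :=
  match l, l' with
  | x :: l, y :: l' => (f x - f y) ^+ count_mem k ks * diff_prod k.+1 l l'
  | _, _ => 1
  end.

Lemma diff_prodE k l l' : size l = size l' ->
  diff_prod k l l' = \prod_(j < size l)
    ((map f l)`_j - (map f l')`_j) ^+ count_mem (k + j)%N ks.
Proof.
elim: l l' k => [|x l IHl] [|y l'] k //= => [_|[sl]]; first by rewrite big_ord0.
rewrite big_ord_recl /= addn0 IHl //; congr (_ * _).
by apply: eq_bigr => j _; rewrite /= addSnnS.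
Qed.

(* The conditional expectation of the factors with times in [k, k + m) of the
   product, given that the two chains are at x and y at time k - 1. *)
Definition value m k x y : R :=
  \sum_(l : m.-tuple 'I_N) \sum_(l' : m.-tuple 'I_N)
    wprod A x l * wprod A y l' * diff_prod k l l'.

Lemma value0 k x y : value 0 k x y = 1.
Proof.
rewrite /value (big_tuple0 (fun l => \sum_(l' : 0.-tuple 'I_N)
    wprod A x l * wprod A y l' * diff_prod k l l')) /=.
rewrite (big_tuple0 (fun l' => wprod A x [::] * wprod A y l' * 1)) /=.
by rewrite !mulr1.
Qed.

Lemma valueS m k x y : value m.+1 k x y =
  kop2 A (fun x' y' => (f x' - f y') ^+ count_mem k ks * value m k.+1 x' y') x y.
Proof.
rewrite /value (big_tuple_cons _ (fun l => \sum_(l' : m.+1.-tuple 'I_N)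
    wprod A x l * wprod A y l' * diff_prod k l l')) /= /kop2 /kop.
apply: eq_bigr => x' _; rewrite big_distrr /=.
under eq_bigr => l _ do rewrite (big_tuple_cons _ (fun l' =>
  wprod A x (x' :: l) * wprod A y l' * diff_prod k (x' :: l) l')) /=.
rewrite exchange_big; apply: eq_bigr => y' _ /=.
rewrite !big_distrr; apply: eq_bigr => l _ /=.
rewrite !big_distrr; apply: eq_bigr => l' _ /=.
by ring.
Qed.

Lemma value_swap m k x y : value m k y x = (-1) ^+ tail_count ks m k * value m k x y.
Proof.
elim: m k x y => [|m IHm] k x y.
  rewrite !value0 mulr1 /tail_count (eq_count (a2 := pred0)) ?count_pred0 //.
  by move=> t /=; lia.
rewrite !valueS tail_countS /kop2 /kop; under eq_bigr do rewrite big_distrr /=.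
rewrite exchange_big big_distrr; apply: eq_bigr => x' _ /=.
rewrite !big_distrr; apply: eq_bigr => y' _ /=.
by rewrite IHm -(opprB (f x') (f y')) (exprNn (f x' - f y')) exprD; ring.
Qed.

(** Backwards in time, by [valueS]. Each factor f x - f y is at most 2 in absolute value and costs 4
    in [msq2]. Each transition is a contraction, and gains [rho] when [value_swap] makes its
    argument antisymmetric. *)
Lemma msq2_value_le m k : msq2 pi (value m k) <=
  4 ^+ tail_count ks m k * rho A pi ^+ odd_gaps ks m k.
Proof.
have rho0 : 0 <= rho A pi.
  by rewrite /rho divr_ge0 // addr_ge0 // sqr_ge0.
elim: m k => [|m IHm] k.
  have -> : tail_count ks 0 k = 0%N.
    by rewrite /tail_count (eq_count (a2 := pred0)) ?count_pred0 // => t /=; lia.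
  rewrite /odd_gaps big_ord0 !expr0 mulr1.
  have pi1 : \sum_i pi 0 i = 1 by case: pi_pos.
  rewrite /msq2 /mean /msq; under eq_bigr => x _ do under eq_bigr => y _ do rewrite value0 expr1n mulr1.
  by rewrite -big_distrl /= pi1 mulr1.
pose g x y := (f x - f y) ^+ count_mem k ks * value m k.+1 x y.
have -> : msq2 pi (value m.+1 k) = msq2 pi (kop2 A g).
  by apply: eq_bigr => x _; congr (_ * _); apply: eq_bigr => y _; rewrite valueS.
have pi0 i : 0 <= pi 0 i by case: pi_pos => /(_ i)/ltW.
have gle : msq2 pi g <= 4 ^+ count_mem k ks * msq2 pi (value m k.+1).
  rewrite /msq2 /mean big_distrr; apply: ler_sum => x _ /=.
  rewrite [leRHS]mulrCA ler_wpM2l // /msq big_distrr; apply: ler_sum => y _ /=.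
  rewrite [leRHS]mulrCA ler_wpM2l // /g exprMn ler_wpM2r ?sqr_ge0 //.
  rewrite -exprM mulnC exprM lerXn2r ?nnegrE ?sqr_ge0 //.
  by have := f1 x; have := f1 y; nra.
have gle2 : msq2 pi g <= 4 ^+ tail_count ks m.+1 k * rho A pi ^+ odd_gaps ks m k.+1.
  apply: le_trans gle _; rewrite tail_countS exprD -mulrA ler_wpM2l ?exprn_ge0 //.
rewrite odd_gapsS; case: (boolP (odd _)) => [odd_k|_]; last first.
  by rewrite add0n; apply: le_trans gle2; apply: msq2_kop2_le.
rewrite add1n exprS mulrCA; apply: le_trans (_ : rho A pi * msq2 pi g <= _).
  apply: msq2_kop2_antisym => // x y.
  rewrite /g value_swap -(opprB (f x) (f y)) (exprNn (f x - f y)) mulrACA -exprD.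
  by rewrite -tail_countS -signr_odd odd_k expr1; ring.
by rewrite ler_wpM2l.
Qed.

Definition path_prob (l : seq 'I_N) : R :=
  if l is x :: l' then pi 0 x * wprod A x l' else 1.

(** No transition precedes time 0, so its factors are split off into g. The mean of g is bounded by
    its L2 norm, which turns 4 into 2 and [rho] into its square root. *)
Lemma symmetrized_moment n : all (fun t => t <= n)%N ks ->
  \sum_(s : n.+1.-tuple 'I_N) \sum_(s' : n.+1.-tuple 'I_N)
    path_prob s * path_prob s' * \prod_(k <- ks) ((map f s)`_k - (map f s')`_k) <=
  2 ^+ size ks * Num.sqrt (rho A pi) ^+ odd_gaps ks n 1.
Proof.
move=> ksn; pose g x y := (f x - f y) ^+ count_mem 0%N ks * value n 1 x y.
have -> : \sum_(s : n.+1.-tuple 'I_N) \sum_(s' : n.+1.-tuple 'I_N)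
    path_prob s * path_prob s' * \prod_(k <- ks) ((map f s)`_k - (map f s')`_k) =
    mean2 pi g.
  transitivity (\sum_(s : n.+1.-tuple 'I_N) \sum_(s' : n.+1.-tuple 'I_N)
      path_prob s * path_prob s' * diff_prod 0 s s').
    apply: eq_bigr => s _; apply: eq_bigr => s' _; congr (_ * _).
    rewrite diff_prodE ?size_tuple //.
    by rewrite (@prod_count_nat _ n.+1 (fun k => (map f s)`_k - (map f s')`_k)).
  rewrite (big_tuple_cons _ (fun s => \sum_(s' : n.+1.-tuple 'I_N)
      path_prob s * path_prob s' * diff_prod 0 s s')) /= /mean2 /mean.
  apply: eq_bigr => x _; rewrite big_distrr /=.
  under eq_bigr => l _ do rewrite (big_tuple_cons _ (fun s' =>
    path_prob (x :: l) * path_prob s' * diff_prod 0 (x :: l) s')) /=.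
  rewrite exchange_big; apply: eq_bigr => y _ /=.
  rewrite /g /value !big_distrr; apply: eq_bigr => l _ /=.
  rewrite !big_distrr; apply: eq_bigr => l' _ /=.
  by ring.
have rho0 : 0 <= rho A pi.
  by rewrite /rho divr_ge0 // addr_ge0 // sqr_ge0.
have pi0 i : 0 <= pi 0 i by case: pi_pos => /(_ i)/ltW.
have gle : msq2 pi g <= 4 ^+ count_mem 0%N ks * msq2 pi (value n 1).
  rewrite /msq2 /mean big_distrr; apply: ler_sum => x _ /=.
  rewrite [leRHS]mulrCA ler_wpM2l // /msq big_distrr; apply: ler_sum => y _ /=.
  rewrite [leRHS]mulrCA ler_wpM2l // /g exprMn ler_wpM2r ?sqr_ge0 //.
  rewrite -exprM mulnC exprM lerXn2r ?nnegrE ?sqr_ge0 //.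
  by have := f1 x; have := f1 y; nra.
set B := _ * _; have B0 : 0 <= B by rewrite mulr_ge0 ?exprn_ge0 ?sqrtr_ge0.
apply: le_trans (ler_norm _) _.
rewrite -(@ler_pXn2r _ 2) ?nnegrE // real_normK ?num_real //.
apply: le_trans (sqr_mean2_le pi_pos g) _; apply: le_trans gle _.
have -> : B ^+ 2 = 4 ^+ count_mem 0%N ks *
    (4 ^+ tail_count ks n 1 * rho A pi ^+ odd_gaps ks n 1).
  rewrite mulrA -exprD -tail_countS /B exprMn -!exprM ![(_ * 2)%N]mulnC !exprM.
  rewrite sqr_sqrtr //; congr (_ ^+ _ * _); first by rewrite expr2; ring.
  by symmetry; apply/eqP; rewrite -all_count.
by rewrite ler_wpM2l ?exprn_ge0 // msq2_value_le.
Qed.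

End Mixing.

(** * The law of a trajectory *)

Definition traj (T : Type) (N : nat) (Y : nat -> T -> 'I_N) n t : n.-tuple 'I_N :=
  [tuple Y i t | i < n].

Section PathLaw.
Variables (R : realType) (disp : measure_display) (T : measurableType disp).
Variables (P : probability T R) (N : nat) (A : 'M[R]_N) (pi : 'rV[R]_N).
Variable Y : nat -> T -> 'I_N.
Hypothesis chain : stationary_markov_chain P A pi Y.

Lemma measurable_history s n : measurable (history Y s n).
Proof.
have [_ _ _ [mY _] _] := chain.
rewrite (_ : history Y s n = \bigcap_(k in [set k | (k <= n)%N]) Y k @^-1` [set s k]).
  by apply: bigcap_measurable => [|k _]; [exists 0%N | exact: mY].
by apply/seteqP; split => t H k /= kn; apply: H.
Qed.

Lemma historyS s n :
  history Y s n.+1 = (Y n.+1 @^-1` [set s n.+1]) `&` history Y s n.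
Proof.
apply/seteqP; split => t.
  by move=> H; split=> [|k kn]; apply: H; rewrite // leqW.
move=> [Yn H] k; rewrite leq_eqVlt => /predU1P[-> //|kn]; exact: H.
Qed.

Lemma history_prob s n :
  P (history Y s n) = (pi 0 (s 0%N) * \prod_(k < n) A (s k) (s k.+1))%:E.
Proof.
have [_ _ _ [mY cY] P0] := chain; elim: n => [|n IHn].
  rewrite big_ord0 mulr1 -P0; congr (P _); apply/seteqP; split => t.
    by move=> /(_ 0%N); apply.
  by move=> Y0 k; rewrite leqn0 => /eqP ->.
have mH := measurable_history s n; have mF := mY n.+1 (s n.+1).
rewrite historyS big_ord_recr /= mulrA.
have finF : P ((Y n.+1 @^-1` [set s n.+1]) `&` history Y s n) \is a fin_num.
  by rewrite fin_num_measure //; apply: measurableI.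
(* The Markov property is silent about null histories; there both sides vanish. *)
have [H0|H0] := eqVneq (P (history Y s n)) 0%E.
  move: (H0); rewrite IHn => -[->]; rewrite mul0r.
  apply/eqP; rewrite -measure_le0 -H0; apply: le_measure; rewrite ?inE //.
  by apply: measurableI.
have := cY _ _ H0; rewrite /cond_prob IHn /= => E.
have nz : pi 0 (s 0%N) * \prod_(i < n) A (s i) (s i.+1) != 0.
  by move: H0; rewrite IHn; apply: contra_neq => ->.
by rewrite -(fineK finF) [in RHS]mulrC -E divfK.
Qed.

Lemma traj_history n x0 (s : n.+1.-tuple 'I_N) :
  [set t | traj Y n.+1 t = s] = history Y (nth x0 s) n.
Proof.
apply/seteqP; split => t /=.
  by move=> <- k kn; rewrite -(tnth_nth _ _ (Ordinal (kn : (k < n.+1)%N))) tnth_mktuple.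
move=> H; apply: eq_from_tnth => i; rewrite tnth_mktuple (tnth_nth x0).
by rewrite H // -ltnS.
Qed.

Lemma wprod_nth x0 x l :
  wprod A x l = \prod_(k < size l) A (nth x0 (x :: l) k) (nth x0 l k).
Proof.
elim: l x => [|y l IHl] x /=; first by rewrite big_ord0.
by rewrite big_ord_recl /= IHl.
Qed.

Lemma traj_prob n (s : n.+1.-tuple 'I_N) :
  P [set t | traj Y n.+1 t = s] = (path_prob A pi s)%:E.
Proof.
rewrite (traj_history (thead s)) history_prob; case/tupleP: s => x l.
by rewrite theadE /= (wprod_nth x) size_tuple.
Qed.

Lemma measurable_traj n (s : n.+1.-tuple 'I_N) : measurable [set t | traj Y n.+1 t = s].
Proof. by rewrite (traj_history (thead s)); apply: measurable_history. Qed.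

Lemma integral_traj n (G : seq 'I_N -> R) : (forall s, 0 <= G s) ->
  (\int[P]_t (G (traj Y n.+1 t))%:E =
   (\sum_(s : n.+1.-tuple 'I_N) path_prob A pi s * G s)%:E)%E.
Proof.
move=> G0.
rewrite (eq_integral (fun t => \sum_(s : n.+1.-tuple 'I_N)
    (G s)%:E * (\1_[set t | traj Y n.+1 t = s] t)%:E)%E) => [|t _]; last first.
  rewrite (bigD1 (traj Y n.+1 t)) //= big1 ?adde0.
    by rewrite indicE mem_set // mule1.
  by move=> s /eqP ts; rewrite indicE memNset ?mule0 //= => /esym.
have mI (s : n.+1.-tuple 'I_N) :
    measurable_fun [set: T] (EFin \o (\1_[set t | traj Y n.+1 t = s] : T -> R)).
  by apply/measurable_EFinP/measurable_indic/measurable_traj.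
rewrite ge0_integral_sum //=.
- rewrite -sumEFin; apply: eq_bigr => s _.
  rewrite ge0_integralZl //; [|exact: mI|by rewrite lee_fin].
  rewrite integral_indic //; last exact: measurable_traj.
  rewrite setIT mulrC EFinM; congr (_ * _)%E; exact: traj_prob.
- by move=> s; apply: measurable_funeM; exact: mI.
- by move=> s t _; rewrite mule_ge0 // lee_fin.
Qed.

(** The positive and negative parts are integrated separately, each being a finite sum of indicators
    of trajectories. *)
Lemma expectation_traj n (G : seq 'I_N -> R) :
  ('E_P[fun t => G (traj Y n.+1 t)] =
   (\sum_(s : n.+1.-tuple 'I_N) path_prob A pi s * G s)%:E)%E.
Proof.
rewrite unlock integralE.
rewrite (eq_integral (fun t => (Num.max (G (traj Y n.+1 t)) 0)%:E)); last first.
  by move=> t _; rewrite funeposE /= EFin_max.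
rewrite [X in (_ - X)%E](eq_integral (fun t => (Num.max (- G (traj Y n.+1 t)) 0)%:E)); last first.
  by move=> t _; rewrite funenegE /= EFin_max.
rewrite (integral_traj n (G := fun s => Num.max (G s) 0)); last first.
  by move=> s; rewrite le_max lexx orbT.
rewrite (integral_traj n (G := fun s => Num.max (- G s) 0)); last first.
  by move=> s; rewrite le_max lexx orbT.
rewrite -EFinB; congr EFin; rewrite -sumrB; apply: eq_bigr => s _.
rewrite -mulrBr; congr (_ * _); rewrite !maxEle.
by case: (leP (G s) 0); case: (leP (- G s) 0); lra.
Qed.

Lemma path_prob_ge0 s : 0 <= path_prob A pi s.
Proof.
have [[A0 _] [pi0 _] _ _ _] := chain.
case: s => //= x l; rewrite mulr_ge0 ?(ltW (pi0 x)) //.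
by elim: l x => //= y l IHl x; rewrite mulr_ge0.
Qed.

Lemma path_prob_sum n : \sum_(s : n.+1.-tuple 'I_N) path_prob A pi s = 1.
Proof.
have := expectation_traj n (fun=> 1); rewrite expectation_cst => -[->].
by apply: eq_bigr => s _; rewrite mulr1.
Qed.

End PathLaw.

(** * Conclusion *)

(** The constant 64 is a product of three factors 4: from the bound 2 on each difference, squared;
    from the squared mass of the weights, at most 4 / (1 - mu); and from 1 / (1 - mu) <= 4 / (1 -
    lam). *)
Lemma symmetrized_trace (R : realType) (N : nat) (A : 'M[R]_N) (pi : 'rV[R]_N)
    (f : 'I_N -> R) n d (b : 'M[R]_d) (omega : 'I_d * 'I_d -> 'I_n.+1) p :
  row_stochastic A -> positive_distribution pi -> invariant_distribution A pi ->
  (forall i, -1 <= f i <= 1) -> L2opnorm pi (A - averaging pi) < 1 ->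
  (0 < d)%N -> b^T = b -> (forall i j, 0 <= b i j <= 1) ->
  {in upper d &, injective omega} -> (0 < p)%N ->
  (forall i, \sum_j b i j ^+ 2 <= p%:R) ->
  \sum_(s : n.+1.-tuple 'I_N) \sum_(s' : n.+1.-tuple 'I_N)
    path_prob A pi s * path_prob A pi s' *
    \tr ((kmx b (fun k => (map f s)`_(omega k) - (map f s')`_(omega k))) ^+ (p * 2)) <=
  d%:R ^+ 2 * (64 / (1 - L2opnorm pi (A - averaging pi)) * (rademacher_const R * p%:R)) ^+ p.
Proof.
move=> Asto pi_pos pi_inv f1 lam1 d0 bT b01 omegaI p0 rowb.
have L0 := L2opnorm_ge0 Asto pi_pos pi_inv.
pose mu := Num.sqrt (rho A pi).
have rho0 : 0 <= rho A pi by rewrite /rho divr_ge0 // addr_ge0 // sqr_ge0.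
have mu0 : 0 <= mu by apply: sqrtr_ge0.
have mu2 : mu ^+ 2 = (1 + L2opnorm pi (A - averaging pi) ^+ 2) / 2 by rewrite sqr_sqrtr.
have moment ks := symmetrized_moment Asto pi_pos pi_inv f1 (ltW lam1) (ks := ks) (n := n).
rewrite -/mu in moment.
set lam := L2opnorm pi (A - averaging pi) in L0 lam1 mu2 *.
have mu1 : mu < 1 by nra.
have gap : (1 - mu)^-1 <= 4 / (1 - lam).
  rewrite ler_pdivlMr ?subr_gt0 // mulrC ler_pdivrMr ?subr_gt0 //.
  have : (1 - mu) * (1 + mu) = (1 - lam) * (1 + lam) / 2 by nra.
  by nra.
have := @moving_average_params _ n mu; rewrite mu0 mu1.
move=> /(_ isT)[S [al [al0 al_large a0 a_le]]].
pose E := {ffun 'I_(n + S).+1 -> bool}.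
have E0 : 0 < #|{: E}|%:R :> R by rewrite ltr0n card_ffun expn_gt0 card_bool.
have dom (ks : seq ('I_d * 'I_d)) : size ks = (p * 2)%N ->
    \sum_(s : n.+1.-tuple 'I_N * n.+1.-tuple 'I_N)
      path_prob A pi s.1 * path_prob A pi s.2 *
      \prod_(k <- ks) ((map f s.1)`_(omega k) - (map f s.2)`_(omega k)) <=
    2 ^+ (p * 2) * \sum_(e : E) #|{: E}|%:R^-1 *
      \prod_(k <- ks) moving_average al mu (omega k) e.
  (* Both products depend only on the multiset of times, so the times may be sorted, as the pairing
     of consecutive ones requires. *)
  move=> ksp; pose ts := sort leq (map (fun k => nat_of_ord (omega k)) ks).
  have ts_perm : perm_eq ts (map (fun k => nat_of_ord (omega k)) ks) by rewrite perm_sort.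
  have ts_n : all (fun t => t <= n)%N ts.
    by rewrite (perm_all _ ts_perm) all_map; apply/allP => k _ /=; rewrite -ltnS.
  have ts_size : size ts = (p * 2)%N by rewrite size_sort size_map.
  have ts_sorted : sorted leq ts by apply: sort_sorted => x y; apply: leq_total.
  have ts_even : ~~ odd (size ts) by rewrite ts_size oddM andbF.
  have toTs (F : nat -> R) : \prod_(k <- ks) F (omega k) = \prod_(t <- ts) F t.
    by rewrite (perm_big _ ts_perm) big_map.
  rewrite -(pair_bigA _ (fun s s' : n.+1.-tuple 'I_N =>
    path_prob A pi s * path_prob A pi s' *
      \prod_(k <- ks) ((map f s)`_(omega k) - (map f s')`_(omega k)))) /=.
  under eq_bigr => s _ do under eq_bigr => s' _ do
    rewrite (toTs (fun t => (map f s)`_t - (map f s')`_t)).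
  apply: le_trans (moment ts ts_n) _.
  rewrite ts_size ler_wpM2l ?exprn_ge0 // odd_gaps_sorted //.
  rewrite -big_distrr /= mulrC ler_pdivlMr // mulrC.
  under eq_bigr => e _ do rewrite (toTs (fun t => moving_average al mu t e)).
  exact: moving_average_moment.
have b0 i j : 0 <= b i j by case/andP: (b01 i j).
have := trace_dominate b0 dom.
rewrite -(pair_bigA _ (fun s s' : n.+1.-tuple 'I_N =>
    path_prob A pi s * path_prob A pi s' *
    \tr ((kmx b (fun k => (map f s)`_(omega k) - (map f s')`_(omega k))) ^+ (p * 2)))) /=.
move=> H; apply: le_trans H _.
rewrite -big_distrr /=.
have := moving_average_trace al0 mu0 a0 d0 bT b01 omegaI p0 rowb.
rewrite mulrC -ler_pdivrMr // mulrC => H.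
apply: (@le_trans _ _ (2 ^+ (p * 2) * (d%:R ^+ 2 *
   ((\sum_(s < S) al * mu ^+ s) ^+ 2 * (rademacher_const R * p%:R)) ^+ p))).
  by rewrite ler_wpM2l ?exprn_ge0.
have K0 : 0 <= rademacher_const R * p%:R.
  by rewrite /rademacher_const; apply: mulr_ge0; [apply: mulr_ge0; [apply: exprn_ge0|]|]; rewrite ?ler0n.
move: (rademacher_const R * p%:R) K0 => K K0.
rewrite mulrCA; apply: ler_wpM2l; first by rewrite sqr_ge0.
rewrite mulnC exprM -exprMn; apply: lerXn2r; rewrite ?nnegrE.
- by apply: mulr_ge0; [exact: exprn_ge0|apply: mulr_ge0 => //; exact: sqr_ge0].
- by apply: mulr_ge0 => //; apply: divr_ge0 => //; rewrite subr_ge0 ltW.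
rewrite mulrA; apply: ler_wpM2r => //.
apply: (@le_trans _ _ (2 ^+ 2 * (4 / (1 - mu)))); first by rewrite ler_wpM2l.
have -> : 2 ^+ 2 * (4 / (1 - mu)) = 16 * (1 - mu)^-1 by rewrite mulrA; congr (_ * _); ring.
have -> : 64 / (1 - lam) = 16 * (4 / (1 - lam)) by rewrite mulrA; congr (_ * _); ring.
by rewrite ler_wpM2l.
Qed.

(** Either x <= t, or x is at most the power term. With t the root of a bound on the moment, this
    passes from the moment to the mean at the cost of a factor 2, without taking roots of
    expectations. *)
Lemma le_power_mix (R : realFieldType) (x t : R) m : 0 < t -> 0 <= x ->
  x <= t + t * (x ^+ m.+1 / t ^+ m.+1).
Proof.
move=> t0 x0; rewrite -expr_div_n; set y := x / t.
have -> : x = t * y by rewrite /y mulrC divfK // gt_eqF.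
have y0 : 0 <= y by rewrite divr_ge0 // ltW.
rewrite -[X in X + _]mulr1 -mulrDr ler_pM2l //.
have [y1|y1] := leP y 1.
  by apply: le_trans y1 _; rewrite lerDl exprn_ge0.
apply: le_trans (_ : y ^+ m.+1 <= _); last by rewrite lerDr.
by rewrite exprS -[leLHS]mulr1 ler_pM2l ?exprn_ege1 ?ltW // (lt_trans _ y1).
Qed.

(** Since f(Y') has mean zero, averaging over the second copy s' recovers the matrix of the first.
    The triangle inequality then plays the part of Jensen's inequality, and [le_power_mix] brings in
    the trace moment. *)
Lemma expected_schatten_le (R : realType) (N : nat) (A : 'M[R]_N) (pi : 'rV[R]_N)
    (f : 'I_N -> R) n d (b : 'M[R]_d) (omega : 'I_d * 'I_d -> 'I_n.+1) p beta tau :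
  (forall s, 0 <= path_prob A pi s) ->
  \sum_(s : n.+1.-tuple 'I_N) path_prob A pi s = 1 ->
  (forall k : 'I_n.+1, \sum_(s : n.+1.-tuple 'I_N) path_prob A pi s * (map f s)`_k = 0) ->
  (0 < d)%N -> b^T = b -> 0 <= beta -> 0 < tau -> (0 < p)%N ->
  \sum_(s : n.+1.-tuple 'I_N) \sum_(s' : n.+1.-tuple 'I_N)
    path_prob A pi s * path_prob A pi s' *
    \tr ((kmx b (fun k => (map f s)`_(omega k) - (map f s')`_(omega k))) ^+ (p * 2)) <=
    tau ^+ (p * 2) ->
  \sum_(s : n.+1.-tuple 'I_N) path_prob A pi s *
    schatten_infty (kmx (beta *: b) (fun k => (map f s)`_(omega k))) <=
  2 * beta * tau.
Proof.
move=> P0 P1 Pf d0 bT beta0 tau0 p0 tr_le.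
pose M (s s' : n.+1.-tuple 'I_N) := kmx b (fun k => (map f s)`_(omega k) - (map f s')`_(omega k)).
have MT s s' : (M s s')^T = M s s' by apply: kmx_sym.
have p2 : (p * 2)%N = (p * 2).-1.+1 by rewrite prednK // muln_gt0 p0.
have bound (s : n.+1.-tuple 'I_N) : schatten_infty (kmx (beta *: b) (fun k => (map f s)`_(omega k))) <=
    \sum_(s' : n.+1.-tuple 'I_N) (path_prob A pi s' * beta) *
      (tau + tau * (\tr (M s s' ^+ (p * 2)) / tau ^+ (p * 2))).
  have -> : kmx (beta *: b) (fun k => (map f s)`_(omega k)) =
      \sum_(s' : n.+1.-tuple 'I_N) (path_prob A pi s' * beta) *: M s s'.
    apply/matrixP => i j; rewrite summxE !mxE.
    rewrite (eq_bigr (fun s' : n.+1.-tuple 'I_N =>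
       beta * b i j * (map f s)`_(omega (key i j)) * path_prob A pi s' -
       beta * b i j * (path_prob A pi s' * (map f s')`_(omega (key i j))))) => [|s' _].
      by rewrite sumrB -!big_distrr /= P1 Pf; ring.
    by rewrite !mxE; ring.
  apply: le_trans (schatten_sum d0 _ _) _ => [s'|s'|].
  - by rewrite mulr_ge0.
  - exact: MT.
  apply: ler_sum => s' _; rewrite ler_wpM2l ?mulr_ge0 //.
  apply: le_trans (le_power_mix (p * 2).-1 tau0 (schatten_ge0 d0 (MT s s'))) _.
  rewrite -p2 lerD2l ler_pM2l // ler_pM2r ?invr_gt0 ?exprn_gt0 //.
  exact: schatten_exp_le_trace.
have taup : 0 < tau ^+ (p * 2) by rewrite exprn_gt0.
apply: (@le_trans _ _ (beta * tau * (1 + (tau ^+ (p * 2))^-1 *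
  \sum_(s : n.+1.-tuple 'I_N) \sum_(s' : n.+1.-tuple 'I_N)
    path_prob A pi s * path_prob A pi s' * \tr (M s s' ^+ (p * 2))))).
  apply: (@le_trans _ _ (\sum_(s : n.+1.-tuple 'I_N) path_prob A pi s *
    \sum_(s' : n.+1.-tuple 'I_N) (path_prob A pi s' * beta) *
      (tau + tau * (\tr (M s s' ^+ (p * 2)) / tau ^+ (p * 2))))).
    by apply: ler_sum => s _; apply: ler_wpM2l.
  rewrite le_eqVlt; apply/orP; left; apply/eqP.
  rewrite mulrDr mulr1 -[X in _ = X + _]mulr1 -{1}P1 mulrA !big_distrr /= -big_split /=.
  apply: eq_bigr => s _; rewrite !big_distrr /=.
  rewrite -[X in _ = beta * tau * X + _]mulr1 -{1}P1 !big_distrr /= -big_split /=.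
  by apply: eq_bigr => s' _; ring.
have -> : 2 * beta * tau = beta * tau * (1 + 1) by ring.
apply: ler_wpM2l; first by rewrite mulr_ge0 // ltW.
by rewrite lerD2l mulrC ler_pdivrMr // mul1r.
Qed.

Lemma nth_map_traj (R : realType) (T : Type) (N : nat) (Y : nat -> T -> 'I_N)
    (f : 'I_N -> R) n (k : 'I_n) t : (map f (traj Y n t))`_k = f (Y k t).
Proof.
rewrite (nth_map (Y k t)) ?size_tuple // -[k in nth _ _ k]/(val k).
by rewrite -tnth_nth tnth_mktuple.
Qed.

Lemma chain_matrix_kmx (R : realType) (T : Type) (N d n : nat)
    (Y : nat -> T -> 'I_N) (f : 'I_N -> R) (B : 'M[R]_d)
    (omega : 'I_d * 'I_d -> 'I_n) (t : T) : B^T = B ->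
  chain_matrix Y f B omega t = kmx B (fun k => (map f (traj Y n t))`_(omega k)).
Proof.
move=> BT; apply/matrixP => i j; rewrite !mxE nth_map_traj inE /key /=.
by case: leqP => // _; rewrite -{1}BT mxE.
Qed.

Section RowNorms.
Variables (R : realType) (d : nat) (B : 'M[R]_d).
Let sigma := max_row_norm B.
Let beta := max_entry B.

Lemma max_row_norm_ge0 : 0 <= sigma.
Proof. exact: bigmax_ge_id. Qed.

Lemma row_le_max i : \sum_j B i j ^+ 2 <= sigma ^+ 2.
Proof.
have rs : 0 <= \sum_j B i j ^+ 2 by apply: sumr_ge0 => j _; apply: sqr_ge0.
rewrite -(sqr_sqrtr rs) lerXn2r ?nnegrE ?sqrtr_ge0 ?max_row_norm_ge0 //.
exact: (le_bigmax _ (fun i => Num.sqrt (\sum_j B i j ^+ 2))).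
Qed.

Lemma entry_le_max i j : `|B i j| <= beta.
Proof.
apply: le_trans (le_bigmax _ (fun i => \big[Num.max/0]_j `|B i j|) i).
exact: (le_bigmax _ (fun j => `|B i j|)).
Qed.

Lemma max_entry_le_row : beta <= sigma.
Proof.
apply/bigmax_leP; split=> [|i _]; first exact: max_row_norm_ge0.
apply/bigmax_leP; split=> [|j _]; first exact: max_row_norm_ge0.
rewrite -(@ler_pXn2r _ 2) ?nnegrE ?max_row_norm_ge0 // real_normK ?num_real //.
apply: le_trans (row_le_max i); rewrite (bigD1 j) //= lerDl.
by apply: sumr_ge0 => k _; apply: sqr_ge0.
Qed.

End RowNorms.

Lemma natr_le_expR1_exp (R : realType) (d p : nat) : (0 < d)%N ->
  ln d%:R <= p%:R :> R -> d%:R <= expR 1 ^+ p :> R.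
Proof.
move=> d0 dp; rewrite -expRM_natl mulr1 -[leLHS]lnK ?posrE ?ltr0n //.
by rewrite ler_expR.
Qed.

(* The moment order p is chosen as sigma^2 / sigma_*^2 + log d, up to
   rounding. *)
Lemma max_entry_sqrt_le (R : realType) (sigma beta l : R) (p : nat) :
  0 < beta -> beta <= sigma -> 0 <= l -> p%:R <= (sigma / beta) ^+ 2 + l + 1 ->
  beta * Num.sqrt p%:R <= 2 * (sigma + beta * Num.sqrt l).
Proof.
move=> b0 bs l0 pl; have s0 : 0 <= sigma by apply: le_trans bs; apply: ltW.
have rhs0 : 0 <= sigma + beta * Num.sqrt l.
  by rewrite addr_ge0 // mulr_ge0 ?sqrtr_ge0 // ltW.
rewrite -(@ler_pXn2r _ 2) ?nnegrE ?mulr_ge0 ?sqrtr_ge0 ?(ltW b0) //.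
rewrite exprMn sqr_sqrtr //.
apply: (@le_trans _ _ (beta ^+ 2 * ((sigma / beta) ^+ 2 + l + 1))).
  by rewrite ler_wpM2l ?sqr_ge0.
have -> : beta ^+ 2 * ((sigma / beta) ^+ 2 + l + 1) =
    sigma ^+ 2 + beta ^+ 2 * l + beta ^+ 2 by field; rewrite gt_eqF.
rewrite -{1}(sqr_sqrtr l0) -exprMn.
have := sqrtr_ge0 l; set y := Num.sqrt l => y0.
have : 0 <= beta * y by rewrite mulr_ge0 // ltW.
by move: (beta * y) => z z0; nra.
Qed.

Theorem corollary1p4 (R : realType) :
  exists C : R,
  forall (disp : measure_display) (T : measurableType disp)
    (P : probability T R) (N : nat) (A : 'M[R]_N) (pi : 'rV[R]_N)
    (Y : nat -> T -> 'I_N),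
  stationary_markov_chain P A pi Y ->
  forall f : 'I_N -> R,
  (forall i, -1 <= f i <= 1) ->
  (forall k, ('E_P[fun t => f (Y k t)] = 0)%E) ->
  forall (d : nat) (B : 'M[R]_d),
  (0 < d)%N ->
  B^T = B ->
  (forall i j, 0 < B i j) ->
  forall omega : 'I_d * 'I_d -> 'I_((d ^ 2 + d) %/ 2),
  {in upper_pairs d &, injective omega} ->
  let lambda := L2opnorm pi (A - averaging pi) in
  ('E_P[fun t => schatten_infty (chain_matrix Y f B omega t)]
     <= mine (spectral_gap_bound C lambda B) (schatten_infty B)%:E)%E.
Proof.
(* The factor e^2 absorbs d^2 <= e^(2 p). The 4 in front of the root below is a 2 from
   [expected_schatten_le] times a 2 from [max_entry_sqrt_le]. *)
pose D : R := 64 * expR 1 ^+ 2 * rademacher_const R.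
have D0 : 0 < D.
  apply: mulr_gt0; [apply: mulr_gt0|apply: mulr_gt0; [apply: exprn_gt0|]];
    by rewrite ?ltr0n // exprn_gt0 // expR_gt0.
exists (4 * Num.sqrt D) => disp T P N A pi Y chain f f1 Ef d B d0 BT Bpos.
have : (0 < (d ^ 2 + d) %/ 2)%N by rewrite divn_gt0 //; nia.
case: ((d ^ 2 + d) %/ 2)%N => [|n] n_gt0 omega omegaI; first by rewrite ltnn in n_gt0.
cbv zeta; set lambda := L2opnorm pi (A - averaging pi).
have [Asto pi_pos pi_inv _ _] := chain.
have upI : {in upper d &, injective omega}.
  by move=> k l ku lu; apply: omegaI; rewrite inE.
pose X (s : seq 'I_N) := kmx B (fun k => (map f s)`_(omega k)).
have -> : (fun t => schatten_infty (chain_matrix Y f B omega t)) =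
    (fun t => schatten_infty (X (traj Y n.+1 t))).
  by apply/funext => t; rewrite chain_matrix_kmx.
rewrite (expectation_traj chain n (fun s => schatten_infty (X s))).
have P0 := path_prob_ge0 chain; have P1 := path_prob_sum chain n.
have Pf (k : 'I_n.+1) : \sum_(s : n.+1.-tuple 'I_N) path_prob A pi s * (map f s)`_k = 0.
  have := expectation_traj chain n (fun s => (map f s)`_k).
  have -> : (fun t => (map f (traj Y n.+1 t))`_k) = (fun t => f (Y k t)).
    by apply/funext => t; rewrite nth_map_traj.
  by rewrite Ef => -[].
rewrite le_min; apply/andP; split; last first.
  (* The trivial bound: since |f| <= 1, every realisation is dominated entrywise by B. *)
  rewrite lee_fin -[leRHS]mul1r -P1 big_distrl; apply: ler_sum => s _ /=.
  rewrite ler_wpM2l //; apply: schatten_entrywise_le => // [|i j].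
    exact: kmx_sym.
  rewrite mxE normrM (gtr0_norm (Bpos i j)) -[leRHS]mul1r ler_wpM2r ?(ltW (Bpos i j)) //.
  by rewrite (nth_map (thead s)) ?size_tuple // ler_norml f1.
rewrite /spectral_gap_bound; case: ifP => lam1; last by rewrite leey.
rewrite lee_fin; set sigma := max_row_norm B; set beta := max_entry B.
have beta0 : 0 < beta.
  pose i0 := Ordinal d0; apply: lt_le_trans (entry_le_max B i0 i0).
  by rewrite gtr0_norm.
have beta_sigma : beta <= sigma by apply: max_entry_le_row.
have l0 : 0 <= ln d%:R :> R by rewrite ln_ge0 // ler1n.
(* From p >= z it follows both that the squared rows of B / beta sum to at most p and that d <= e^p,
   while p <= z + 1 keeps beta sqrt p within twice sigma + beta sqrt (log d). *)
pose z := (sigma / beta) ^+ 2 + ln d%:R.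
have z0 : 0 <= z by rewrite addr_ge0 ?sqr_ge0.
pose p := (Num.truncn z).+1.
have zp : z <= p%:R by apply/ltW/truncnS_gt.
have pz : p%:R <= z + 1 by rewrite -natr1 lerD2r truncn_le.
pose b := beta^-1 *: B.
have Bb : B = beta *: b by rewrite scalerA divff ?scale1r // gt_eqF.
have bT : b^T = b by rewrite linearZ /= BT.
have b01 i j : 0 <= b i j <= 1.
  rewrite mxE mulr_ge0 ?invr_ge0 ?(ltW beta0) ?(ltW (Bpos i j)) //=.
  rewrite mulrC ler_pdivrMr // mul1r; apply: le_trans (entry_le_max B i j).
  exact: ler_norm.
have rowb i : \sum_j b i j ^+ 2 <= p%:R.
  apply: le_trans zp; apply: (@le_trans _ _ ((sigma / beta) ^+ 2)).
    rewrite (eq_bigr (fun j => B i j ^+ 2 * beta^-1 ^+ 2)) => [|j _].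
      by rewrite -big_distrl /= exprMn ler_wpM2r ?sqr_ge0 // row_le_max.
    by rewrite mxE exprMn mulrC.
  by rewrite lerDl.
have gap0 : 0 < 1 - lambda by rewrite subr_gt0.
(* Chosen so that tau^(2 p) is the bound on the trace moment with d^2 replaced by e^(2 p). *)
pose tau := Num.sqrt D * Num.sqrt p%:R / Num.sqrt (1 - lambda).
have tau0 : 0 < tau by rewrite divr_gt0 ?mulr_gt0 ?sqrtr_gt0 // ltr0n.
have tau2 : tau ^+ 2 = D * p%:R / (1 - lambda).
  by rewrite /tau expr_div_n exprMn !sqr_sqrtr // ltW.
have tr_le := symmetrized_trace Asto pi_pos pi_inv f1 lam1 d0 bT b01 upI (ltn0Sn _) rowb.
have dp : d%:R <= expR 1 ^+ p :> R.
  by apply: natr_le_expR1_exp => //; apply: le_trans zp; rewrite lerDr sqr_ge0.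
have tot_le : d%:R ^+ 2 * (64 / (1 - lambda) * (rademacher_const R * p%:R)) ^+ p <= tau ^+ (p * 2).
  have -> : tau ^+ (p * 2) = (expR 1 ^+ p) ^+ 2 * (64 / (1 - lambda) * (rademacher_const R * p%:R)) ^+ p.
    rewrite mulnC exprM tau2 -exprM mulnC exprM -exprMn; congr (_ ^+ p).
    by rewrite /D; move: (rademacher_const R) (expR 1) => K e; ring.
  apply: ler_wpM2r; last by apply: lerXn2r; rewrite ?nnegrE ?ler0n // exprn_ge0 ?expR_ge0.
  apply/exprn_ge0/mulr_ge0; first by rewrite divr_ge0 ?(ltW gap0).
  by rewrite /rademacher_const mulr_ge0 ?ler0n // mulr_ge0 ?exprn_ge0.
have := expected_schatten_le P0 P1 Pf d0 bT (ltW beta0) tau0 (ltn0Sn _) (le_trans tr_le tot_le).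
rewrite -Bb => H; apply: le_trans H _.
have := max_entry_sqrt_le beta0 beta_sigma l0 pz => pb.
have -> : 2 * beta * tau = 2 * (Num.sqrt D / Num.sqrt (1 - lambda)) * (beta * Num.sqrt p%:R).
  by rewrite /tau; move: (Num.sqrt D) (Num.sqrt p%:R) (Num.sqrt _)^-1 => x y w; ring.
have -> : 4 * Num.sqrt D / Num.sqrt (1 - lambda) * (sigma + beta * Num.sqrt (ln d%:R)) =
    2 * (Num.sqrt D / Num.sqrt (1 - lambda)) * (2 * (sigma + beta * Num.sqrt (ln d%:R))).
  move: (sigma + beta * Num.sqrt _) (Num.sqrt D) (Num.sqrt (1 - lambda))^-1 => w x y.
  by ring.
by apply: ler_wpM2l => //; rewrite mulr_ge0 // divr_ge0 ?sqrtr_ge0.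
Qed.
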